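(* Let $f_1,\dots,f_n:\mathbb{R}^d\to\mathbb{R}$ and consider the problem $\min_{x\in\mathbb{R}^d}\{f(x):=\frac1n\sum_{i=1}^n f_i(x)\}$. Suppose $f$ is differentiable and $L$-smooth, i.e. $\|\nabla f(x)-\nabla f(y)\|\le L\|x-y\|$ for all $x,y\in\mathbb{R}^d$, that there is $f^*\in\mathbb{R}$ with $f(x)\ge f^*$ for all $x\in\mathbb{R}^d$, and put $\Delta:=f(x^0)-f^*$, where $x^0$ is the starting point. Suppose that for all $i\in[n]$ worker $i$ can only calculate stochastic gradients $\nabla f_i(x;\xi)$ with $\mathbb{E}_\xi[\nabla f_i(x;\xi)]=\nabla f_i(x)$ and $\mathbb{E}_\xi[\|\nabla f_i(x;\xi)-\nabla f_i(x)\|^2]\le\sigma^2$ for all $x\in\mathbb{R}^d$, where $\sigma^2\ge0$. Let $\varepsilon>0$. Then Leon SGD (described in the context) finds an $\varepsilon$-stationary point of this problem after $K=\Theta(L\Delta/\varepsilon)$ iterations, and, under the computation and communication model described in the context, its time complexity is $$\mathcal{O}\left(\max\left\{\frac{d}{\bar w_1},\ \max_{i\in[n]}h_i,\ \frac{\sigma^2}{n\varepsilon}\left(\frac1n\sum_{i=1}^n h_i\right)\right\}\frac{L\Delta}{\varepsilon}\right)$$ seconds, where $\bar w_1:=\min_{\{i,j\}\in F}w_{ij}$ is the minimum edge weight of a Gomory–Hu tree $T=(V,F,w)$ of $\bar G$. Equivalently, $\bar w_1$ is the global minimum cut value of $G$.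
   Context: Notation: $[n]=\{1,\dots,n\}$. An $\varepsilon$-stationary point is a (possibly random) point $\bar x\in\mathbb{R}^d$ with $\mathbb{E}[\|\nabla f(\bar x)\|^2]\le\varepsilon$. A method with iterates $x^0,x^1,\dots$ is said to find an $\varepsilon$-stationary point after $K$ iterations if a point chosen uniformly at random (independently) from $x^0,\dots,x^{K-1}$ is $\varepsilon$-stationary. The paper assumes $d$ is large. Computation model: worker $i\in[n]$ needs $h_i>0$ seconds to compute one stochastic gradient; workers compute in parallel, and random samples are i.i.d. (independent across workers). Communication model: there is a directed connected weighted graph $G=(V,E,b)$ with $V=[n]$ (vertices are workers) such that $(i,j)\in E$ implies $(j,i)\in E$ and $b_{ij}=b_{ji}>0$; $b_{ij}$ is the number of coordinates/bits per second that worker $i$ can send to worker $j$ over edge $(i,j)$. Workers can send and receive simultaneously and asynchronously over all edges, overlap communication and computation, split vectors over several routes, interleave several streams on one edge, and an intermediate node may add incoming coordinates and forward the result immediately as coordinates arrive. There are no latencies; all operations other than stochastic gradient computations and transmissions take negligible (zero) time. The undirected version is $\bar G=(V,\bar E,b)$, where $\{i,j\}\in\bar E$ with weight $b_{ij}$ iff $(i,j),(j,i)\in E$ with weight $b_{ij}$. Cuts: for $U\subseteq V$, $\delta(U)$ is the set of edges of $\bar G$ with exactly one endpoint in $U$; the value of the cut $(U,V\setminus U)$ is $\sum_{e\in\delta(U)}b_e$. The global minimum cut value is the minimum over $\emptyset\ne U\subsetneq V$. For $S\subseteq V$, an $S$-cut is a partition $(U,V\setminus U)$ with $U\cap S\ne\emptyset$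 and $(V\setminus U)\cap S\neq\emptyset$; $\alpha_{\bar G}(S)$ is the minimum value of an $S$-cut. A Gomory–Hu tree of $\bar G$ is a weighted tree $T=(V,F,w)$ such that for every $\{i,j\}\in F$, if $W$ is one component of $T-\{i,j\}$, then $\delta(W)$ is a minimum $i$–$j$ cut in $\bar G$ and $w_{ij}$ is its value. For $n=1$, $\bar w_1=\infty$ and $d/\bar w_1=0$. Leon SGD: all workers start from $x^0$ with step size $\gamma=\frac1{2L}$. For $k=0,1,\dots$: (i) all workers compute, in parallel and continuously, $\frac1{B_i}\sum_{j=1}^{B_i}\nabla f_i(x^k;\xi^k_{ij})$, increasing the local batch sizes $B_i$ over time, until $\big(\frac1n\sum_{i=1}^n\frac1{B_i}\big)^{-1}\ge\max\{\lceil\sigma^2/\varepsilon\rceil,n\}/n$; (ii) they run an optimal-bandwidth AllReduce (below, with $S=[n]$) so that all workers obtain $\frac1n\sum_{i=1}^n\frac1{B_i}\sum_{j=1}^{B_i}\nabla f_i(x^k;\xi^k_{ij})$; (iii) every worker sets $x^{k+1}=x^k-\frac{\gamma}{n}\sum_{i=1}^n\frac1{B_i}\sum_{j=1}^{B_i}\nabla f_i(x^k;\xi^k_{ij})$. Optimal-bandwidth AllReduce for $S\subseteq V$ (worker $i\in S$ holds $a_i\in\mathbb{R}^d$; all workers of $S$ must obtain $\sum_{i\in S}a_i$; no communication is needed if $|S|=1$): bandwidths are taken to be integers (rational bandwidths are renormalized by a common denominator). Let $\hat G$ be the unweighted multigraph in which each $\{i,j\}\in\bar E$ is repeated $b_{ij}$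 times, each copy with unit bandwidth (simulated by interleaving on the real edge). Once, as preprocessing, find edge-disjoint trees $\hat T_1,\dots,\hat T_p$ in $\hat G$, each connecting all vertices of $S$, with $p$ equal to $\alpha_{\bar G}(S)$ up to a universal constant factor (Steiner tree packing; a polynomial-time algorithm of Lau (2004) provides it), and fix a pivot $v\in S$. Each $i\in S$ splits $a_i$ into $p$ blocks of size $\lceil d/p\rceil$ (zero padding if needed). In parallel over $j\in[p]$, the $j$-th blocks are summed at $v$ along $\hat T_j$ with coordinate-by-coordinate streaming and aggregation at intermediate nodes; then the summed $j$-th block is broadcast from $v$ to $S$ along $\hat T_j$ in the same streaming manner. *)

(* Defs.v *)
From HB Require Import structures.
From mathcomp Require Export all_boot all_order all_algebra.
From mathcomp Require Export all_classical all_reals all_analysis.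

Set Implicit Arguments.
Unset Strict Implicit.
Unset Printing Implicit Defensive.

Import Order.TTheory GRing.Theory Num.Theory.
Import numFieldNormedType.Exports.

Local Open Scope classical_set_scope.
Local Open Scope ring_scope.

(* The library norm on 'rV[R]_d is the sup norm, hence this definition. *)
Definition enorm (R : realType) (d : nat) (x : 'rV[R]_d) : R :=
  Num.sqrt (\sum_q x 0 q ^+ 2).

Definition grad (R : realType) (d : nat) (f : 'rV[R]_d -> R) (x : 'rV[R]_d)
    : 'rV[R]_d :=
  \row_q 'D_(delta_mx 0 q) f x.

Definition favg (R : realType) (n d : nat) (f : 'I_n -> 'rV[R]_d -> R)
    (x : 'rV[R]_d) : R :=
  n%:R^-1 * \sum_i f i x.

Definition L_smooth (R : realType) (d : nat) (f : 'rV[R]_d -> R) (L : R) : Prop :=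
  (forall x, differentiable f x) /\
  (forall x y, enorm (grad f x - grad f y) <= L * enorm (x - y)).

(* [G i x s] is the stochastic gradient of worker i at x with sample s, where
   s has law [D i].  Joint measurability in (x, s), with the product
   sigma-algebra on R^d, makes the stochastic gradients at random points
   random variables. *)
Definition stochastic_oracle (R : realType) (n d : nat) (dX : measure_display)
    (Xi : measurableType dX) (D : 'I_n -> probability Xi R)
    (f : 'I_n -> 'rV[R]_d -> R) (G : 'I_n -> 'rV[R]_d -> Xi -> 'rV[R]_d)
    (sigma : R) : Prop :=
  [/\ forall i x, differentiable (f i) x,
      forall i (q : 'I_d), measurable_fun [set: (d.-tuple R * Xi)%type]
        (fun z : d.-tuple R * Xi => G i (\row_r tnth z.1 r) z.2 0 q),
      forall i x (q : 'I_d),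
        ('E_(D i)[fun s => (G i x s 0 q)%R] = ((grad (f i) x 0 q)%R)%:E)%E
    & forall i x,
        ('E_(D i)[fun s => (enorm (G i x s - grad (f i) x) ^+ 2)%R]
           <= (sigma ^+ 2)%:E)%E].

Definition mutually_independent (R : realType) (dO dX : measure_display)
    (Omega : measurableType dO) (Xi : measurableType dX)
    (P : probability Omega R) (I : eqType) (X : I -> {RV P >-> Xi}) : Prop :=
  forall (J : seq I) (A : I -> set Xi), uniq J ->
    (forall t, measurable (A t)) ->
    P (\bigcap_(t in [set` J]) (X t @^-1` A t)) =
      (\prod_(t <- J) fine (P (X t @^-1` A t)))%:E.

Definition independent_of_family (R : realType) (dO dX dY : measure_display)
    (Omega : measurableType dO) (Xi : measurableType dX) (Y : measurableType dY)
    (P : probability Omega R) (I : eqType) (X : I -> {RV P >-> Xi})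
    (tau : {RV P >-> Y}) : Prop :=
  forall (J : seq I) (A : I -> set Xi) (B : set Y), uniq J ->
    (forall t, measurable (A t)) -> measurable B ->
    P (tau @^-1` B `&` \bigcap_(t in [set` J]) (X t @^-1` A t)) =
      (P (tau @^-1` B) * P (\bigcap_(t in [set` J]) (X t @^-1` A t)))%E.

(* Sample [xi (k, i, j)] is the j-th sample drawn by worker i at iteration k. *)
Definition iid_samples (R : realType) (n : nat) (dO dX : measure_display)
    (Omega : measurableType dO) (Xi : measurableType dX)
    (P : probability Omega R) (D : 'I_n -> probability Xi R)
    (xi : nat * 'I_n * nat -> {RV P >-> Xi}) : Prop :=
  (forall k i j A, measurable A -> distribution P (xi (k, i, j)) A = D i A) /\
  mutually_independent xi.

Definition uniform_index (R : realType) (dO : measure_display)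
    (Omega : measurableType dO) (P : probability Omega R)
    (K : nat) (tau : {RV P >-> nat}) : Prop :=
  forall k, (k < K)%N -> distribution P tau [set k] = (K%:R^-1)%:E.

(* Workers are 'I_n.  Bandwidths are rationals with common denominator [den]:
   the edge {i, j} carries [mult i j / den] coordinates per second in each
   direction, and there is no such edge when [mult i j = 0].  [mult] is also the
   edge multiplicity of the unweighted multigraph. *)
Record network (n : nat) := Network {
  mult : 'I_n -> 'I_n -> nat;
  den : nat;
  den_gt0 : (0 < den)%N;
  mult_irr : forall i, mult i i = 0%N;
  mult_sym : forall i j, mult i j = mult j i;
  mult_connected : forall i j, connect [rel a b | (0 < mult a b)%N] i j }.

Definition bandwidth (R : realType) (n : nat) (G : network n) (i j : 'I_n) : R :=
  (mult G i j)%:R / (den G)%:R.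

Definition cut_value (R : realType) (n : nat) (G : network n) (U : {set 'I_n}) : R :=
  \sum_(i in U) \sum_(j in ~: U) bandwidth R G i j.

(* Equals +oo when n = 1. *)
Definition global_mincut (R : realType) (n : nat) (G : network n) : \bar R :=
  \big[Order.min/+oo%E]_(U : {set 'I_n} | (U != finset.set0) && (U != [set: 'I_n]%SET))
    (cut_value R G U)%:E.

(* The vertex set of the component of i after removing the edge {i, j}. *)
Definition tree_side (n : nat) (F : rel 'I_n) (i j : 'I_n) : {set 'I_n} :=
  [set k | connect [rel a b | F a b && ([set a; b]%SET != [set i; j]%SET)] i k]%SET.

Definition is_tree (n : nat) (F : rel 'I_n) : Prop :=
  [/\ symmetric F, irreflexive F, (forall i j, connect F i j)
    & forall i j, F i j -> j \notin tree_side F i j].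

Definition gomory_hu (R : realType) (n : nat) (G : network n)
    (F : rel 'I_n) (w : 'I_n -> 'I_n -> R) : Prop :=
  is_tree F /\
  forall i j, F i j ->
    w i j = cut_value R G (tree_side F i j) /\
    forall U : {set 'I_n}, i \in U -> j \notin U ->
      cut_value R G (tree_side F i j) <= cut_value R G U.

Definition min_tree_weight (R : realType) (n : nat) (F : rel 'I_n)
    (w : 'I_n -> 'I_n -> R) : \bar R :=
  \big[Order.min/+oo%E]_(e : 'I_n * 'I_n | F e.1 e.2) (w e.1 e.2)%:E.

(* Tree j < [npk] is a spanning tree stored as its orientation towards [pivot]:
   it consists of the edges {u, par j u}, u != pivot, and uses copy [copy j u]
   among the [mult u (par j u)] parallel copies of that edge. *)
Record packing (n : nat) (G : network n) := Packing {
  npk : nat;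
  pivot : 'I_n;
  par : nat -> 'I_n -> 'I_n;
  copy : nat -> 'I_n -> nat;
  npk_gt0 : (0 < npk)%N;
  par_reach : forall j u, (j < npk)%N -> exists k, iter k (par j) u = pivot;
  copy_lt : forall j u, (j < npk)%N -> u != pivot ->
    (copy j u < mult G u (par j u))%N;
  edge_disjoint : forall j j' u u', (j < npk)%N -> (j' < npk)%N ->
    u != pivot -> u' != pivot ->
    [set u; par j u]%SET = [set u'; par j' u']%SET -> copy j u = copy j' u' ->
    j = j' }.

(* The minimum cut value for the integer (renormalized) bandwidths. *)
Definition multi_mincut (R : realType) (n : nat) (G : network n) : \bar R :=
  ((den G)%:R%:E * global_mincut R G)%E.

(* The reverse bound npk <= multi_mincut holds for every packing, since each of
   the edge-disjoint spanning trees crosses every cut. *)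
Definition near_optimal (R : realType) (n : nat) (G : network n) (kappa : R)
    (T : packing G) : Prop :=
  (1 < n)%N -> (multi_mincut R G <= (kappa * (npk T)%:R)%:E)%E.

(* "d is large": coordinates being indivisible, streaming a block through a
   tree costs up to n extra time slots to fill the pipeline, which must be
   negligible against the d / multi_mincut slots of the transfer itself. *)
Definition large_dim (R : realType) (n : nat) (G : network n) (d : nat) : Prop :=
  (1 < n)%N -> (n%:R%:E * multi_mincut R G <= d%:R%:E)%E.

(* Arrival times, in slots, on a unit-bandwidth link (one coordinate per slot,
   in order) of a stream whose c-th coordinate is available at [ready c]. *)
Fixpoint pipeline (ready : nat -> nat) (c : nat) : nat :=
  (maxn (ready c) (if c is c'.+1 then pipeline ready c' else 0%N)).+1.

Definition block_size (d p : nat) : nat := ((d + p.-1) %/ p)%N.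

Definition padded (R : realType) (d : nat) (v : 'rV[R]_d) (q : nat) : R :=
  if insub q is Some i then v 0 i else 0.

Section AllReduce.
Variables (R : realType) (n : nat) (G : network n) (T : packing G).

Definition child (j : nat) (u w : 'I_n) : bool :=
  (w != pivot T) && (par T j w == u).

(* In the recursions along a tree, [fuel] bounds the depth; n always suffices. *)

(* Slot at which u has received coordinate c of the j-th block from all its
   children, i.e. can forward its own partial sum. *)
Fixpoint up_ready (fuel j : nat) (u : 'I_n) (c : nat) : nat :=
  if fuel is k.+1 then (\max_(w | child j u w) pipeline (up_ready k j w) c)%N
  else 0%N.

Fixpoint up_sum (fuel j : nat) (a : 'I_n -> nat -> R) (u : 'I_n) (c : nat) : R :=
  a u c + (if fuel is k.+1 then \sum_(w | child j u w) up_sum k j a w c else 0).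

(* Slot at which u holds coordinate c of the summed j-th block, when the
   broadcast of that block starts at slot s. *)
Fixpoint down_ready (fuel j s : nat) (u : 'I_n) (c : nat) : nat :=
  if u == pivot T then s
  else if fuel is k.+1 then pipeline (down_ready k j s (par T j u)) c else 0%N.

Fixpoint down_val (fuel j : nat) (z : nat -> R) (u : 'I_n) (c : nat) : R :=
  if u == pivot T then z c
  else if fuel is k.+1 then down_val k j z (par T j u) c else 0.

Definition allreduce_slots (d : nat) : nat :=
  let m := block_size d (npk T) in
  (\max_(j < npk T) \max_(u < n) \max_(c < m)
     down_ready n j (\max_(c' < m) up_ready n j (pivot T) c') u c)%N.

(* A unit-bandwidth link carries 1 / den coordinates per second. *)
Definition allreduce_time (d : nat) : R := (den G)%:R * (allreduce_slots d)%:R.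

(* The vector obtained by worker u when worker i holds [a i]. *)
Definition allreduce (d : nat) (a : 'I_n -> 'rV[R]_d) (u : 'I_n) : 'rV[R]_d :=
  let m := block_size d (npk T) in
  \row_(q < d)
    (let j := (q %/ m)%N in
     let block i c := padded (a i) (j * m + c)%N in
     down_val n j (up_sum n j block (pivot T)) u (q %% m)%N).

End AllReduce.

Definition batches (R : realType) (n : nat) (h : 'I_n -> R) (t : R) (i : 'I_n) : nat :=
  Num.truncn (t / h i).

(* An empty batch counts as 1 / B_i = +oo, so that the condition then fails. *)
Definition enough (R : realType) (n : nat) (sigma eps : R) (B : 'I_n -> nat) : Prop :=
  (forall i, (0 < B i)%N) /\
  Num.max (Num.ceil (sigma ^+ 2 / eps))%:~R n%:R / n%:R
    <= (n%:R^-1 * \sum_i (B i)%:R^-1)^-1 :> R.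

Definition compute_time (R : realType) (n : nat) (h : 'I_n -> R) (sigma eps : R) : R :=
  inf [set t : R | 0 <= t /\ enough sigma eps (batches h t)].

(* Iterates held by each worker, for a realization s of the samples. *)
Fixpoint leon (R : realType) (n d : nat) (Xi : Type) (G : network n)
    (T : packing G) (g : 'I_n -> 'rV[R]_d -> Xi -> 'rV[R]_d) (gamma : R)
    (B : 'I_n -> nat) (x0 : 'rV[R]_d) (s : nat * 'I_n * nat -> Xi)
    (k : nat) : 'I_n -> 'rV[R]_d :=
  if k is k'.+1 then
    let x := leon T g gamma B x0 s k' in
    let a i := (B i)%:R^-1 *: \sum_(j < B i) g i (x i) (s (k', i, val j)) in
    fun u => x u - (gamma / n%:R) *: allreduce T a u
  else fun=> x0.

(* Seconds elapsed when all workers hold their k-th iterate. *)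
Fixpoint leon_clock (R : realType) (n : nat) (G : network n) (T : packing G)
    (d : nat) (h : 'I_n -> R) (sigma eps : R) (k : nat) : R :=
  if k is k'.+1 then
    leon_clock T d h sigma eps k' + compute_time h sigma eps + allreduce_time R T d
  else 0.

(* Since +oo^-1 = 0 in \bar R, the first term vanishes when n = 1. *)
Definition time_scale (R : realType) (n d : nat) (h : 'I_n -> R) (sigma eps : R)
    (w1 : \bar R) : \bar R :=
  Order.max (d%:R%:E * w1^-1)%E
    (Num.max (\big[Num.max/0]_i h i)
       (sigma ^+ 2 / (n%:R * eps) * (n%:R^-1 * \sum_i h i)))%:E.

(* Main.v *)
(** Time: splitting a vector over p edge-disjoint spanning trees and streaming its
    blocks costs O(d/p + n) unit-bandwidth slots, which is O(d / mincut) as soon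
    as p is within a constant of the minimum cut and d is large.  Such a packing
    exists by a weak form of the Nash-Williams--Tutte theorem: half of the
    minimum cut, obtained by matroid partition in the graphic matroid followed
    by counting the edges that cross between tight components.  Waiting for four
    times max(max h, sigma^2 / (n eps) * mean h) makes every batch large enough.

    Iterations: the AllReduce is exact, so the workers follow the recursion
    x^(k+1) = x^k - gamma (grad f(x^k) + e^k).  The descent inequality with
    gamma = 1/(2L), multiplied by 8L and telescoped along each path, reads
      sum_(k < K) (3 |grad f(x^k)|^2 + 2 <grad f(x^k), e^k> - |e^k|^2)
        <= 8 L (f(x^0) - fstar),
    and only then are expectations taken.  The cross terms vanish because fresh
    samples are independent of the sigma-algebra of the past ones, and the batch
    sizes make E|e^k|^2 <= eps; hence K >= 4 L Delta / eps iterations suffice. *)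
From HB Require Import structures.
From mathcomp Require Import all_boot all_order all_algebra zify ring lra.

Set Implicit Arguments.
Unset Strict Implicit.
Unset Printing Implicit Defensive.

Import Order.TTheory GRing.Theory Num.Theory.

Local Open Scope ring_scope.

(** * Spanning-tree packing *)

(** Summing the descent inequality pathwise avoids any moment of f(x^k): f(x^K) >= fstar disposes of
    the last value on each path, and the only variables to be integrated are products of gradients
    and noises, square integrable by induction on k. Only the average f is smooth, the f_i being
    merely differentiable, so the measurability of their gradients is extracted from the oracle,
    whose means they are. No conditional expectation appears. The law of a pair formed by a
    past-measurable variable and a fresh sample is a product measure, and Fubini integrates over the
    sample first. The past is the sigma-algebra of the samples in a set Q that varies with the use:
    earlier iterations for the gradient-noise terms, earlier iterations and part of the current
    batch for the cross terms inside a batch, all samples for the random output index. The factor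
    one half lost on the cut has a plain source: an edge joining two components leaves both of them,
    so r components left by 2k edges each account for only rk edges. *)

Section ForestPacking.
Variables (F : fieldType) (vT : vectType F) (E : finType) (v : E -> vT).

Definition eset_span (S : {set E}) : {vspace vT} := <<[seq v e | e <- enum S]>>%VS.

Definition eset_free (S : {set E}) := \dim (eset_span S) == #|S|.

Lemma dim_eset_span S : (\dim (eset_span S) <= #|S|)%N.
Proof. by rewrite cardE -(size_map v); apply: dim_span. Qed.

Lemma mem_eset_span (S : {set E}) e : e \in S -> v e \in eset_span S.
Proof. by move=> eS; apply/memv_span/map_f; rewrite mem_enum. Qed.

Lemma eset_span_sub (S : {set E}) (U : {vspace vT}) :
  (forall e, e \in S -> v e \in U) -> (eset_span S <= U)%VS.
Proof.
move=> SU; apply/span_subvP => _ /mapP[e eS ->].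
by apply: SU; rewrite mem_enum in eS.
Qed.

Lemma eset_spanS (A B : {set E}) : A \subset B -> (eset_span A <= eset_span B)%VS.
Proof.
by move=> /subsetP AB; apply: eset_span_sub => e /AB; apply: mem_eset_span.
Qed.

Lemma eset_spanU1 e (S : {set E}) :
  eset_span (e |: S) = (<[v e]> + eset_span S)%VS.
Proof.
apply/eqP; rewrite eqEsubv; apply/andP; split.
  apply: eset_span_sub => x; rewrite !inE => /predU1P[->|xS].
    exact/(subvP (addvSl _ _))/memv_line.
  exact/(subvP (addvSr _ _))/mem_eset_span.
rewrite subv_add -memvE mem_eset_span ?setU11 //=.
by apply: eset_spanS; apply: subsetUr.
Qed.

Lemma eset_free_dim (S : {set E}) : (#|S| <= \dim (eset_span S))%N -> eset_free S.
Proof. by move=> h; rewrite /eset_free eqn_leq dim_eset_span. Qed.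

Lemma eset_freeU1 e (S : {set E}) :
  eset_free S -> v e \notin eset_span S -> eset_free (e |: S).
Proof.
move=> /eqP fS neS.
have eS : e \notin S by apply: contra neS; apply: mem_eset_span.
apply: eset_free_dim; rewrite cardsU1 eS eset_spanU1 -fS.
rewrite dimv_disjoint_sum; last first.
  apply/eqP; rewrite -subv0; apply/subvP => x; rewrite memv_cap => /andP[].
  move=> /vlineP[a ->]; have [->|a0] := eqVneq a 0; first by rewrite scale0r !mem0v.
  by move=> /(memvZ a^-1); rewrite scalerA mulVf // scale1r (negbTE neS).
rewrite leq_add2r dim_vline; case: eqP => // ve0.
by rewrite ve0 mem0v in neS.
Qed.

(** C is taken inclusion-minimal, so it is the circuit of e in S without e itself. Minimality gives
    each f in C a nonzero coefficient in the expansion of [v e], hence [v f] is recovered from e and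
    the rest of S. *)
Lemma eset_exchange e (S : {set E}) : eset_free S -> e \notin S ->
  v e \in eset_span S ->
  exists2 C : {set E}, C \subset S & v e \in eset_span C /\
    forall f, f \in C -> eset_free (e |: S :\ f).
Proof.
move=> /eqP fS eS veS.
pose Pr (C : {set E}) := (C \subset S) && (v e \in eset_span C).
have PS : Pr S by rewrite /Pr subxx.
have [C /minsetP[/andP[CS veC] Cmin] _] := minset_exists PS.
exists C => //; split=> // f fC.
have fS' : f \in S by apply: (subsetP CS).
have veCf : v e \notin eset_span (C :\ f).
  apply/negP => h; have := Cmin (C :\ f).
  rewrite /Pr h (subset_trans (subsetDl _ _) CS) => /(_ isT (subsetDl _ _)).
  by move=> /setP/(_ f); rewrite !inE eqxx fC.
have vf : v f \in eset_span (e |: S :\ f).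
  move: veC; rewrite -(setD1K fC) eset_spanU1.
  move=> /memv_addP[_ /vlineP[a ->] [y yC ev]].
  have a0 : a != 0.
    by apply/eqP => a0; rewrite ev a0 scale0r add0r yC in veCf.
  have -> : v f = a^-1 *: (v e - y) by rewrite ev addrK scalerA mulVf // scale1r.
  apply: memvZ; apply: memvB; first by apply: mem_eset_span; rewrite setU11.
  apply: (subvP (eset_spanS _)) yC.
  by apply: subset_trans (subsetUr _ _); apply: setSD.
apply: eset_free_dim; rewrite cardsU1 !inE negb_and negbK eS orbT.
have -> : (true + #|S :\ f| = #|S|)%N by rewrite (cardsD1 f S) fS'.
rewrite -{1}fS; apply/dimvS; apply: eset_span_sub => x xS.
have [->//|xf] := eqVneq x f.
by apply: mem_eset_span; rewrite !inE xf xS orbT.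
Qed.

Section Coloring.
Variable k : nat.
Implicit Type c : {ffun E -> option 'I_k}.

Definition color_class c i := [set e | c e == Some i].
Definition free_coloring c := [forall i, eset_free (color_class c i)].
Definition swap_color c e i f : {ffun E -> option 'I_k} :=
  [ffun x => if x == e then Some i else if x == f then None else c x].
Definition swap_step c c' := free_coloring c' &&
  [exists e, exists i, exists f,
    [&& c e == None, c f == Some i & c' == swap_color c e i f]].
Definition colored c := [set e | c e != None].

Lemma swap_color_class c e i f j : c e = None -> c f = Some i ->
  color_class (swap_color c e i f) j =
    if j == i then e |: color_class c i :\ f else color_class c j.
Proof.
move=> ce cf; apply/setP => x; rewrite !inE ffunE.
have fe : f != e by apply/eqP => fe; rewrite fe ce in cf.
have [->|xe] := eqVneq x e.
  have [->|ji] := eqVneq j i; first by rewrite !inE !eqxx.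
  by rewrite !inE ce; apply/eqP => -[] /esym/eqP; rewrite (negbTE ji).
have [->|xf] := eqVneq x f.
  case: ifP => [_|/eqP ji]; rewrite !inE.
    by rewrite (negbTE fe) eqxx.
  by rewrite cf; apply/esym/eqP => -[] /esym.
by case: ifP => [/eqP->|_]; rewrite !inE ?(negbTE xe) ?xf.
Qed.

Lemma colored_swap_color c e i f : c e = None -> c f = Some i ->
  #|colored (swap_color c e i f)| = #|colored c|.
Proof.
move=> ce cf.
have fe : f != e by apply/eqP => fe; rewrite fe ce in cf.
have -> : colored (swap_color c e i f) = e |: colored c :\ f.
  apply/setP => x; rewrite !inE ffunE.
  by have [//|xe] := eqVneq x e; have [//|xf] := eqVneq x f.
rewrite cardsU1 !inE ce andbF /=.
by rewrite [in RHS](cardsD1 f) !inE cf.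
Qed.

(* Knuth's and Edmonds' matroid partition argument.  [X] collects the edges left
   uncolored by some coloring reachable from an optimal one by exchanges, so
   that no augmenting-path bookkeeping is needed. *)
Lemma matroid_partition : exists c (X : {set E}),
  [/\ free_coloring c, forall e, c e = None -> e \in X &
    forall x i, x \in X -> v x \in eset_span (color_class c i :&: X)].
Proof.
pose c0 : {ffun E -> option 'I_k} := [ffun=> None].
have fc0 : free_coloring c0.
  apply/forallP => i; have -> : color_class c0 i = set0.
    by apply/setP => x; rewrite !inE ffunE.
  by apply: eset_free_dim; rewrite cards0.
pose c := [arg max_(c > c0 | free_coloring c) #|colored c|].
have [fc cmax] : free_coloring c /\
    forall c', free_coloring c' -> (#|colored c'| <= #|colored c|)%N.
  by rewrite /c; case: arg_maxnP.
pose reach c' := connect swap_step c c'.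
pose X := [set x | [exists c', reach c' && (c' x == None)]].
(* Exchanges preserve the number of colored edges, so every reachable coloring is still optimal. *)
have step_inv c1 c2 : swap_step c1 c2 -> free_coloring c2 /\
    #|colored c2| = #|colored c1|.
  case/andP => f2 /existsP[e /existsP[i /existsP[f /and3P[/eqP ce /eqP cf /eqP c2E]]]].
  by split=> //; rewrite c2E; apply: colored_swap_color.
have path_inv p c1 : free_coloring c1 -> path swap_step c1 p ->
    free_coloring (last c1 p) /\ #|colored (last c1 p)| = #|colored c1|.
  elim: p c1 => //= c2 p IH c1 f1 /andP[/step_inv[f2 s2]] /(IH _ f2)[? ->].
  by rewrite s2.
have reach_inv c' : reach c' -> free_coloring c' /\ #|colored c'| = #|colored c|.
  by case/connectP => p pp ->; apply: path_inv.
(* Were x outside the span of class i, giving it color i would beat the optimum. Each f of its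
   circuit can be swapped out for x, which leaves f uncolored in a reachable coloring; so the whole
   circuit lies in X. *)
have base c' x i : reach c' -> c' x = None ->
    v x \in eset_span (color_class c' i :&: X).
  move=> rc cx; have [fc' sc'] := reach_inv _ rc.
  have fi := forallP fc' i.
  have xi : x \notin color_class c' i by rewrite !inE cx.
  have vx : v x \in eset_span (color_class c' i).
    apply: contraT => nx.
    pose c2 : {ffun E -> option 'I_k} := [ffun y => if y == x then Some i else c' y].
    have /cmax : free_coloring c2.
      apply/forallP => j; have -> : color_class c2 j =
          if j == i then x |: color_class c' i else color_class c' j.
        apply/setP => y; rewrite !inE ffunE; have [->|yx] := eqVneq y x.
          have [->|ji] := eqVneq j i; first by rewrite !inE !eqxx.
          by rewrite !inE cx; apply/eqP => -[] /esym/eqP; rewrite (negbTE ji).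
        by case: ifP => [/eqP->|_]; rewrite !inE ?(negbTE yx).
      by case: ifP => _; [apply: eset_freeU1 | apply: (forallP fc')].
    have -> : colored c2 = x |: colored c'.
      by apply/setP => y; rewrite !inE ffunE; case: (eqVneq y x).
    by rewrite cardsU1 !inE cx /= sc' ltnn.
  have [C CS [vC exC]] := eset_exchange fi xi vx.
  apply: (subvP (eset_spanS _)) vC; apply/subsetP => f fC.
  have fcl := subsetP CS _ fC; rewrite inE fcl /=.
  have cf : c' f = Some i by apply/eqP; rewrite inE in fcl.
  rewrite inE; apply/existsP; exists (swap_color c' x i f); apply/andP; split.
    apply: connect_trans rc _; apply: connect1; apply/andP; split.
      apply/forallP => j; rewrite swap_color_class //.
      by case: ifP => _; [apply: exC | exact: (forallP fc' j)].
    apply/existsP; exists x; apply/existsP; exists i; apply/existsP; exists f.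
    by apply/and3P; split=> //; apply/eqP.
  by rewrite ffunE eqxx; case: (eqVneq f x) => // fx; rewrite fx cx in cf.
(* Going back over a swap loses no span on X: the edge e that entered the class was uncolored
   before, so [base] already puts it in the earlier span. *)
have back p c1 x i : reach c1 -> path swap_step c1 p ->
    v x \in eset_span (color_class (last c1 p) i :&: X) ->
    v x \in eset_span (color_class c1 i :&: X).
  elim: p c1 => //= c2 p IH c1 r1 /andP[s12 pp] h.
  have r2 : reach c2 by apply: connect_trans r1 (connect1 s12).
  have {h} := IH _ r2 pp h; apply: (subvP _).
  case/andP: s12 => f2 /existsP[e /existsP[j /existsP[f]]].
  case/and3P=> /eqP ce /eqP cf /eqP c2E.
  apply: eset_span_sub => y; rewrite c2E inE swap_color_class //.
  case: ifP => [/eqP->|_] /andP[yc yX]; last by apply: mem_eset_span; rewrite inE yc.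
  move: yc; rewrite !inE => /predU1P[->|/andP[_ yc]]; first exact: base.
  by apply: mem_eset_span; rewrite !inE yc; rewrite inE in yX.
exists c, X; split=> //.
  move=> e ce; rewrite inE; apply/existsP; exists c; rewrite ce eqxx andbT.
  exact: connect0.
move=> x i; rewrite inE => /existsP[c' /andP[rc /eqP cx]].
have := base _ _ i rc cx; case/connectP: rc => p pp -> h.
by apply: back h => //; apply: connect0.
Qed.

End Coloring.
End ForestPacking.

(** * The graphic matroid over the rationals, and the counting argument *)

Section GraphicMatroid.
Variables (n : nat) (E : finType) (src tgt : E -> 'I_n).

Definition edge_vec (e : E) : 'rV[rat]_n := delta_mx 0 (src e) - delta_mx 0 (tgt e).
Definition crosses (W : {set 'I_n}) e := (src e \in W) != (tgt e \in W).
Definition edge_rel (S : {set E}) : rel 'I_n :=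
  [rel a b | [exists e in S, ((src e == a) && (tgt e == b)) || ((src e == b) && (tgt e == a))]].

Lemma edge_rel_sym S : symmetric (edge_rel S).
Proof. by move=> a b; apply/eq_existsb => e; rewrite orbC. Qed.

Lemma edge_rel_edge (S : {set E}) e : e \in S -> edge_rel S (src e) (tgt e).
Proof. by move=> eS; apply/existsP; exists e; rewrite eS !eqxx. Qed.

Lemma connect_edge_sym S : connect_sym (edge_rel S).
Proof. by apply: sym_connect_sym; apply: edge_rel_sym. Qed.

(** Used as the linear form that adds the coordinates in W: it vanishes on an edge vector exactly
    when the edge does not cross W. *)
Definition set_form (W : {set 'I_n}) : 'cV[rat]_n := \col_q (q \in W)%:R.

Lemma edge_vec_form e W :
  (edge_vec e *m set_form W) = ((src e \in W)%:R - (tgt e \in W)%:R)%:M.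
Proof.
rewrite mulmxBl -!rowE; apply/matrixP => i j; rewrite !ord1 !mxE eqxx.
by rewrite mulr1n.
Qed.

Lemma span_edge_uncrossed (S : {set E}) W x : (forall e, e \in S -> ~~ crosses W e) ->
  edge_vec x \in eset_span edge_vec S -> ~~ crosses W x.
Proof.
move=> SW xS; pose phi := linfun (mulmxr (set_form W) : 'rV[rat]_n -> 'rV[rat]_1).
have sub : (eset_span edge_vec S <= lker phi)%VS.
  apply: eset_span_sub => e /SW; rewrite negbK => /eqP eW.
  by rewrite memv_ker lfunE /= edge_vec_form eW subrr raddf0.
move: (subvP sub _ xS); rewrite memv_ker lfunE /= edge_vec_form.
move=> /eqP/matrixP/(_ 0 0); rewrite !mxE eqxx mulr1n => /eqP.
by rewrite subr_eq0 eqr_nat /crosses => /eqP; case: (_ \in _); case: (_ \in _).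
Qed.

(** The form of the full vertex set kills every edge vector but no basis vector, so the span is a
    proper subspace. *)
Lemma dim_edge_span S : (0 < n)%N -> (\dim (eset_span edge_vec S) <= n.-1)%N.
Proof.
move=> n0; rewrite -ltnS prednK //.
have nfull : (\dim (eset_span edge_vec S) != n).
  apply/eqP => dn; have /eqP full : eset_span edge_vec S == fullv.
    by rewrite eqEdim subvf dimvf /= /dim /= dn mul1n.
  pose phi := linfun (mulmxr (set_form setT) : 'rV[rat]_n -> 'rV[rat]_1).
  have sub : (eset_span edge_vec S <= lker phi)%VS.
    apply: eset_span_sub => e _.
    by rewrite memv_ker lfunE /= edge_vec_form !inE subrr raddf0.
  have := subvP sub (delta_mx 0 (Ordinal n0)); rewrite full memvf => /(_ isT).
  rewrite memv_ker lfunE /= -rowE => /eqP/matrixP/(_ 0 0); rewrite !mxE inE.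
  by move/eqP; rewrite oner_eq0.
rewrite ltn_neqAle nfull /=; apply: leq_trans (dimvS (subvf _)) _.
by rewrite dimvf /= /dim /= mul1n.
Qed.

Definition component_root S u := fingraph.root (edge_rel S) u.
Definition component_roots S : {set 'I_n} := [set component_root S u | u in 'I_n].

(** Modulo edge vectors, a basis vector equals that of its component root, so one extra generator
    per component yields the whole space. *)
Lemma dim_edge_span_ge S : (n <= \dim (eset_span edge_vec S) + #|component_roots S|)%N.
Proof.
pose dv (u : 'I_n) : 'rV[rat]_n := delta_mx 0 u.
have full : (fullv <= eset_span edge_vec S + eset_span dv (component_roots S))%VS.
  have conn u w : connect (edge_rel S) u w ->
      dv u - dv w \in eset_span edge_vec S.
    case/connectP => p; elim: p u => /= [|u' p IH] u; first by move=> _ ->; rewrite subrr mem0v.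
    move=> /andP[/existsP[e /andP[eS ee]] pp] wE.
    have -> : dv u - dv w = (dv u - dv u') + (dv u' - dv w) by rewrite addrA subrK.
    apply: memvD; last exact: IH.
    have eV := mem_eset_span edge_vec eS.
    case/orP: ee => /andP[/eqP se /eqP te].
      by rewrite -se -te.
    by rewrite -[X in X \in _]opprK memvN opprB -se -te.
  apply/subvP => y _; rewrite [y]row_sum_delta.
  apply: memv_suml => u _; apply: memvZ; rewrite -/(dv u).
  rewrite -[dv u](subrK (dv (component_root S u))); apply: memv_add.
    by apply: conn; apply: connect_root.
  by apply: mem_eset_span; apply: imset_f.
have := leq_trans (dimvS full) (dimv_add_leqif _ _).1.
rewrite dimvf /= /dim /= mul1n => h; apply: leq_trans h _.
by rewrite leq_add2l dim_eset_span.
Qed.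

Definition component S (r : 'I_n) : {set 'I_n} := [set u | component_root S u == r].

(** An edge between two components is counted once at each of them. *)
Lemma sum_crossings S :
  (\sum_(r in component_roots S) #|[set e | crosses (component S r) e]| =
   2 * #|[set e | component_root S (src e) != component_root S (tgt e)]|)%N.
Proof.
under eq_bigr => r _ do rewrite cardE -sum1_size big_enum big_mkcond /=.
rewrite exchange_big /= cardE -sum1_size big_enum big_distrr /= [RHS]big_mkcond /=.
apply: eq_bigr => e _.
under eq_bigr => r _ do rewrite inE /crosses !inE.
rewrite !inE; set a := component_root _ _; set b := component_root _ _.
have [aS bS] : a \in component_roots S /\ b \in component_roots S by split; apply: imset_f.
have [->|ab] /= := eqVneq a b; first by rewrite big1 // => i _; rewrite eqxx.
rewrite (bigD1 a) //= eqxx (eq_sym b) (negbTE ab) /= (bigD1 b) /=; last first.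
  by rewrite bS eq_sym.
rewrite eqxx (negbTE ab) /= big1 // => i /andP[/andP[_ ia] ib].
by rewrite (eq_sym a) (eq_sym b) (negbTE ia) (negbTE ib).
Qed.

Lemma component_setT S r : component S r = setT -> forall u w, connect (edge_rel S) u w.
Proof.
move=> cT u w; rewrite -(root_connect (connect_edge_sym S)).
have /setP cr := cT; have := cr u; have := cr w; rewrite !inE.
by rewrite /component_root => /eqP-> /eqP->.
Qed.

(* Weak form of the Nash-Williams--Tutte theorem. *)
Lemma edge_disjoint_spanning k : (0 < n)%N ->
  (forall W : {set 'I_n}, W != set0 -> W != setT ->
     (2 * k <= #|[set e | crosses W e]|)%N) ->
  exists c : E -> option 'I_k, forall i u w,
    connect (edge_rel [set e | c e == Some i]) u w.
Proof.
move=> n0 cut.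
have [c [X [fc Xc Xspan]]] := matroid_partition edge_vec k.
exists c => i.
(* Class i spans X, so no edge of X leaves a component of class i; if X connects all vertices, so
   does the class. *)
suff connX : forall u w, connect (edge_rel X) u w.
  move=> u w; pose W := [set w | connect (edge_rel (color_class c i)) u w].
  have uncr e : e \in X -> ~~ crosses W e.
    move=> /(Xspan _ i); apply: span_edge_uncrossed => f /setIP[fc' _].
    rewrite negbK !inE; apply/eqP; apply: same_connect_r.
      exact: connect_edge_sym.
    by apply: connect1; apply: edge_rel_edge.
  suff /(_ w) : forall w, w \in W by rewrite inE.
  move=> {}w; have /connectP[p pp ->] := connX u w.
  have: u \in W by rewrite inE connect0.
  elim: p (u) pp => //= b p IH a /andP[/existsP[e /andP[eX ee]] pp] aW.
  apply: IH => //; have := uncr e eX; rewrite negbK.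
  by case/orP: ee => /andP[/eqP-> /eqP->]; rewrite aW; case: (b \in W).
have [[r rT]|noT] : (exists r, component X r = setT) \/ (forall r, component X r != setT).
- case: (pickP (fun r => component X r == setT)) => [r /eqP rT|nT]; [left|right].
    by exists r.
  by move=> r; rewrite nT.
- exact: component_setT rT.
(* Let X have r components. Each is left by at least 2k edges, so at least rk edges join distinct
   components. These lie outside X, hence are colored; but a color has at most n - 1 edges, at least
   n - r of them in X, which leaves at most k(r - 1) edges in all. *)
exfalso.
have k0 : (0 < k)%N by case: (k) i => // -[].
set r := #|component_roots X|.
have r0 : (0 < r)%N by apply/card_gt0P; exists (component_root X (Ordinal n0)); apply: imset_f.
pose Cr := [set e | component_root X (src e) != component_root X (tgt e)].
have low : (r * (2 * k) <= 2 * #|Cr|)%N.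
  rewrite -sum_crossings -sum_nat_const; apply: leq_sum => q /imsetP[u _ ->].
  apply: cut; last exact: noT.
  by apply/set0Pn; exists u; rewrite inE.
have up : (#|Cr| <= \sum_(i < k) #|color_class c i :\: X|)%N.
  apply: (@leq_trans #|\bigcup_(i < k) (color_class c i :\: X)|); last first.
    elim/big_ind2: _ => [|A a B b Aa Bb|//]; first by rewrite cards0.
    exact: leq_trans (leq_card_setU _ _) (leq_add Aa Bb).
  apply: subset_leq_card; apply/subsetP => e; rewrite inE => eC.
  have eX : e \notin X.
    apply: contra eC => eX; rewrite /component_root.
    rewrite (root_connect (connect_edge_sym X)).
    by apply: connect1; apply: edge_rel_edge.
  have: c e <> None by move=> /Xc; rewrite (negbTE eX).
  case ce: (c e) => [j|] // _.
  by apply/bigcupP; exists j => //; rewrite !inE ce eqxx andbT.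
have bound j : (#|color_class c j :\: X| + 1 <= r)%N.
  have h1 : (#|color_class c j| <= n.-1)%N.
    by rewrite -(eqP (forallP fc j)); apply: dim_edge_span.
  have h2 : (n <= #|color_class c j :&: X| + r)%N.
    apply: leq_trans (dim_edge_span_ge X) _; rewrite leq_add2r.
    apply: leq_trans (dim_eset_span edge_vec _).
    by apply: dimvS; apply: eset_span_sub => x /(Xspan _ j).
  have := cardsID X (color_class c j); lia.
have : (\sum_(i < k) #|color_class c i :\: X| <= k * r.-1)%N.
  rewrite -[X in (X * _)%N]card_ord -sum_nat_const; apply: leq_sum => j _.
  by have := bound j; lia.
by nia.
Qed.

End GraphicMatroid.

From mathcomp Require Import measurable_realfun.
Require Import Defs.

Import Order.TTheory GRing.Theory Num.Theory.
Import numFieldNormedType.Exports.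

(** Each vertex points to a neighbour that is strictly fewer steps away from r. *)
Lemma oriented_tree (T : finType) (e : rel T) (r : T) :
  (forall u, connect e u r) ->
  exists par : T -> T, (forall u, u != r -> e u (par u)) /\
    (forall u, exists m, iter m par u = r).
Proof.
move=> conn.
pose far u m := [exists p : m.-tuple T, path e u p && (last u p == r)].
have exfar u : exists m, far u m.
  have /connectP[p pp pr] := conn u.
  by exists (size p); apply/existsP; exists (in_tuple p); rewrite /= pp -pr eqxx.
pose dist u := ex_minn (exfar u).
pose par u := odflt u [pick b | e u b && (dist b < dist u)%N].
have parP u : u != r -> e u (par u) && (dist (par u) < dist u)%N.
  move=> ur; rewrite /par; case: pickP => //= nob.
  move: nob; rewrite {2}/dist; case: ex_minnP => m /existsP[p /andP[pp pr]] _ nob.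
  case: p pp pr => -[|b p] //= sp; first by rewrite (negbTE ur).
  move=> /andP[ub pp] pr; have := nob b; rewrite ub /= -(eqP sp) ltnS.
  rewrite /dist; case: ex_minnP => m' _ /(_ (size p)) -> //.
  by apply/existsP; exists (in_tuple p); rewrite /= pp.
exists par; split=> [u /parP/andP[]//|u].
have [m] := ubnP (dist u); elim: m u => // m IH u um.
have [->|ur] := eqVneq u r; first by exists 0%N.
have /andP[_ du] := parP u ur.
have [|q qr] := IH (par u); first exact: leq_trans du _.
by exists q.+1; rewrite iterSr.
Qed.

(** * From colored edge copies to a packing of spanning trees *)

Section NetworkPacking.
Variables (n : nat) (G : network n).

Definition edge_bound : nat := (\sum_i \sum_j mult G i j)%N.
(** Increasing endpoints make each undirected parallel edge a single element; [edge_bound] is a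
    common bound that keeps the copy numbers in a finite type. *)
Definition edge_copy : finType :=
  {e : 'I_n * 'I_n * 'I_edge_bound |
    (e.1.1 < e.1.2)%N && (e.2 < mult G e.1.1 e.1.2)%N}.
Definition ec_src (e : edge_copy) := (val e).1.1.
Definition ec_tgt (e : edge_copy) := (val e).1.2.

Lemma mult_edge_bound i j : (mult G i j <= edge_bound)%N.
Proof.
rewrite /edge_bound (bigD1 i) //= (bigD1 j) //= -addnA; exact: leq_addr.
Qed.

Lemma edge_copy_of (i j : 'I_n) m : (i < j)%N -> (m < mult G i j)%N ->
  exists e : edge_copy, [/\ ec_src e = i, ec_tgt e = j & (val e).2 = m :> nat].
Proof.
move=> ij mij; have mb : (m < edge_bound)%N by apply: leq_trans mij (mult_edge_bound _ _).
have H : let e := (i, j, Ordinal mb) in (e.1.1 < e.1.2)%N && (e.2 < mult G e.1.1 e.1.2)%N.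
  by rewrite /= ij.
by exists (exist _ (i, j, Ordinal mb) H).
Qed.

Definition mult_cut (W : {set 'I_n}) : nat :=
  (\sum_(i in W) \sum_(j in ~: W) mult G i j)%N.

(** [mult_cut] orients a crossing edge out of W, [edge_copy] by increasing endpoints; the edges
    whose smaller endpoint is outside W have to be swapped. *)
Lemma card_crosses W : #|[set e | crosses ec_src ec_tgt W e]| = mult_cut W.
Proof.
pose cr (e : 'I_n * 'I_n) := (e.1 \in W) != (e.2 \in W).
transitivity (\sum_(e : 'I_n * 'I_n | (e.1 < e.2)%N && cr e) mult G e.1 e.2)%N.
  transitivity (\sum_(e : 'I_n * 'I_n * 'I_edge_bound |
      [&& (e.1.1 < e.1.2)%N, cr e.1 & (e.2 < mult G e.1.1 e.1.2)%N]) 1)%N.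
    rewrite sum1_card -(card_imset _ val_inj); apply: eq_card => e.
    apply/imsetP/idP => [[x]|].
      by rewrite !inE => xW ->; have /andP[h1 h2] := valP x; apply/and3P; split.
    move=> /and3P[e1 e2 e3].
    have H : (e.1.1 < e.1.2)%N && (e.2 < mult G e.1.1 e.1.2)%N by rewrite e1.
    by exists (exist _ e H); rewrite // !inE.
  rewrite (eq_bigl (fun e : 'I_n * 'I_n * 'I_edge_bound => ((e.1.1 < e.1.2)%N && cr e.1)
    && (e.2 < mult G e.1.1 e.1.2)%N)); last by move=> e; rewrite andbA.
  rewrite -(pair_big_dep (fun e : 'I_n * 'I_n => (e.1 < e.2)%N && cr e)
     (fun (e : 'I_n * 'I_n) (m : 'I_edge_bound) => (m < mult G e.1 e.2)%N) (fun _ _ => 1%N)) /=.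
  apply: eq_bigr => e _; rewrite sum1_card.
  have := mult_edge_bound e.1 e.2; move: (mult G _ _) => q qb.
  have winj : injective (widen_ord qb) by move=> x y xy; apply: val_inj; exact: (congr1 val xy).
  rewrite -[RHS]card_ord -(card_imset _ winj).
  apply: eq_card => x; apply/idP/imsetP => [xq|[y _ ->]]; last exact: (ltn_ord y).
  by exists (Ordinal (xq : (x < q)%N)) => //; apply: val_inj.
rewrite (bigID (fun e : 'I_n * 'I_n => e.1 \in W)) /= addnC.
have swK : involutive (fun e : 'I_n * 'I_n => (e.2, e.1)) by case.
rewrite (reindex_inj (inv_inj swK)) /=.
rewrite /mult_cut pair_big_dep /=
  [RHS](bigID (fun e : 'I_n * 'I_n => (e.1 < e.2)%N)) /= [in RHS]addnC.
congr (_ + _)%N.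
  apply: eq_big => [[a b]|[a b] _] /=; last exact: mult_sym.
  rewrite /cr !inE /=; have [ab|ba|/val_inj->] := ltngtP a b; last by rewrite andbN.
    by rewrite andbF.
  by case: (a \in W) (b \in W) => -[].
apply: eq_bigl => -[a b] /=.
by rewrite /cr !inE /=; case: (a \in W) (b \in W) => -[] /=; rewrite ?andbF ?andbT.
Qed.

(** Each color class is oriented towards r. An edge copy is determined by its unordered endpoints
    and its number, and it has at most one color, whence [edge_disjoint]. *)
Lemma packing_of_coloring k (r : 'I_n) (c : edge_copy -> option 'I_k) : (0 < k)%N ->
  (forall i u w, connect (edge_rel ec_src ec_tgt [set e | c e == Some i]) u w) ->
  exists T : packing G, npk T = k.
Proof.
move=> k0 conn.
have /choice[pf pfP] i := oriented_tree (conn i ^~ r).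
pose par j u := if insub j is Some i then pf i u else u.
pose edge_of j u (e : edge_copy) := (omap val (c e) == Some j) &&
  ([set u; par j u]%SET == [set ec_src e; ec_tgt e]%SET).
pose copy j u := if [pick e | edge_of j u e] is Some e then val (val e).2 else 0%N.
have copyP j u : (j < k)%N -> u != r ->
    exists2 e, edge_of j u e & copy j u = (val e).2.
  move=> jk ur; rewrite /copy; case: pickP => [e|noe]; first by exists e.
  have /existsP[e /andP[]] := (pfP (Ordinal jk)).1 u ur.
  rewrite inE => /eqP ce uv; have := noe e; rewrite /edge_of ce /= eqxx /=.
  have -> : par j u = pf (Ordinal jk) u by rewrite /par insubT.
  by case/orP: uv => /andP[/eqP-> /eqP->]; rewrite 1?(finset.setUC [set u]%SET) eqxx.
have ends (a b a' b' : 'I_n) : (a' < b')%N -> [set a; b]%SET = [set a'; b']%SET ->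
    (a = a' /\ b = b') \/ (a = b' /\ b = a').
  move=> ab' ab; have aa : a \in [set a'; b']%SET by rewrite -ab set21.
  have bb : b \in [set a'; b']%SET by rewrite -ab set22.
  have a'a : a' \in [set a; b]%SET by rewrite ab set21.
  have b'b : b' \in [set a; b]%SET by rewrite ab set22.
  case/set2P: aa a'a b'b => ->; case/set2P: bb => ->; [|by left|by right|].
    by move=> _; rewrite !inE orbb => /eqP ba; rewrite ba ltnn in ab'.
  by rewrite !inE orbb => /eqP ba; rewrite ba ltnn in ab'.
unshelve refine (ex_intro _ (@Packing n G k r par copy k0 _ _ _) _) => //.
- move=> j u jk; have [m mr] := (pfP (Ordinal jk)).2 u; exists m.
  by rewrite -mr; apply: eq_iter => x; rewrite /par insubT.
- move=> j u jk ur; have [e /andP[ce /eqP uv] ->] := copyP j u jk ur.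
  case/andP: (valP e) => e12; rewrite -/(ec_src e) -/(ec_tgt e) in e12 *.
  by case: (ends _ _ _ _ e12 uv) => -[-> ->]; rewrite // mult_sym.
- move=> j j' u u' jk jk' ur ur'.
  have [e /andP[ce /eqP->] ->] := copyP j u jk ur.
  have [e' /andP[ce' /eqP->] ->] := copyP j' u' jk' ur'.
  case/andP: (valP e) => e12 _; case/andP: (valP e') => e12' _.
  rewrite -/(ec_src _) -/(ec_tgt _) in e12 e12'.
  move=> ee' m; have {}ee' : e = e'.
    apply: val_inj; case: (ends _ _ _ _ e12' ee') => -[s t].
      move: s t m; rewrite /ec_src /ec_tgt; case: (val e) => -[a b] q.
      case: (val e') => -[a' b'] q' /= -> ->.
      by move=> /val_inj->.
    by move: e12 e12'; rewrite s t => /ltn_trans h /h; rewrite ltnn.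
  by move: ce ce'; rewrite ee' => /eqP-> /eqP[].
Qed.

Lemma cut_value_mult (R : realType) (W : {set 'I_n}) :
  cut_value R G W = (mult_cut W)%:R / (den G)%:R.
Proof.
rewrite /cut_value /mult_cut natr_sum mulr_suml; apply: eq_bigr => i _.
by rewrite natr_sum mulr_suml.
Qed.

Lemma multi_mincut_le (R : realType) (W : {set 'I_n}) :
  W != finset.set0 -> W != [set: 'I_n]%SET ->
  (multi_mincut R G <= (mult_cut W)%:R%:E)%E.
Proof.
move=> W0 WT; have d0 : (0 < (den G)%:R :> R) by rewrite ltr0n den_gt0.
have -> : (mult_cut W)%:R%:E = ((den G)%:R%:E * (cut_value R G W)%:E)%E.
  by rewrite -EFinM cut_value_mult mulrC divfK // gt_eqF.
rewrite /multi_mincut; apply: lee_wpmul2l; first by rewrite lee_fin ltW.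
by apply: (bigmin_le_cond _ (fun U : {set 'I_n} => (cut_value R G U)%:E)); rewrite W0.
Qed.

Lemma packing_exists (R : realType) : (0 < n)%N ->
  exists T : packing G, near_optimal (3 : R) T.
Proof.
move=> n0; pose r := Ordinal n0.
(* With one color on every edge, connectivity of the network alone gives a single spanning tree. *)
have [T0 T0k] : exists T : packing G, npk T = 1%N.
  apply: (@packing_of_coloring 1 r (fun _ => Some ord0)) => // i u w.
  have /connectP[p pp ->] := mult_connected G u w.
  elim: p u pp => //= b p IH u /andP[ub pp].
  apply: connect_trans (IH _ pp); apply: connect1.
  have ne : u != b by apply: contraTneq ub => ->; rewrite mult_irr.
  have [ltub|ltbu] : (u < b)%N \/ (b < u)%N.
    by move: ne; rewrite neq_ltn => /orP.
    have [e [es et _]] := edge_copy_of ltub ub.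
    by apply/existsP; exists e; rewrite inE es et !eqxx (ord1 i) eqxx.
  have [|e [es et _]] := @edge_copy_of b u 0 ltbu; first by rewrite mult_sym.
  by apply/existsP; exists e; rewrite inE es et !eqxx (ord1 i) orbT eqxx.
case: (leqP n 1) => [n1|n1].
  by exists T0; rewrite /near_optimal ltnNge n1.
pose nontriv (W : {set 'I_n}) := (W != finset.set0) && (W != [set: 'I_n]%SET).
have nr : nontriv [set r]%SET.
  apply/andP; split; first by apply/set0Pn; exists r; rewrite inE.
  by apply/eqP => /setP/(_ (Ordinal n1)); rewrite !inE.
pose W := [arg min_(W < [set r]%SET | nontriv W) mult_cut W].
have [/andP[W0 WT] Wmin] : nontriv W /\ forall U, nontriv U -> (mult_cut W <= mult_cut U)%N.
  by rewrite /W; case: arg_minnP.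
(* Origin of the constant 3: for a minimum cut m >= 2 one has m <= 3 floor(m/2), with equality at m
   = 3; below 2 the single tree [T0] is enough. *)
have [T Tk] : exists T : packing G, (mult_cut W <= 3 * npk T)%N.
  have [small|big] := ltnP (mult_cut W) 2; first by exists T0; lia.
  have [|c cP] := @edge_disjoint_spanning n edge_copy ec_src ec_tgt (mult_cut W)./2 n0.
    move=> U U0 UT; rewrite card_crosses; apply: leq_trans (Wmin U _).
      by lia.
    by rewrite /nontriv U0.
  by have [|T Tk] := packing_of_coloring r _ cP; [lia|exists T; lia].
exists T => _; apply: le_trans (multi_mincut_le R W0 WT) _.
by rewrite lee_fin -natrM ler_nat.
Qed.

End NetworkPacking.

(** * AllReduce *)

Section TreeDepth.
Variables (n : nat) (G : network n) (T : packing G) (j : nat).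
Hypothesis jT : (j < npk T)%N.

Lemma reach_pivot u : exists k, iter k (par T j) u == pivot T.
Proof. by have [k /eqP ku] := par_reach u jT; exists k. Qed.

Definition depth u := ex_minn (reach_pivot u).

Lemma depth_pivot : depth (pivot T) = 0%N.
Proof.
rewrite /depth; case: ex_minnP => k _ /(_ 0%N); rewrite /= eqxx leqn0 => /(_ isT).
by move/eqP.
Qed.

Lemma depth0 u : (depth u == 0%N) = (u == pivot T).
Proof.
apply/eqP/eqP => [|->]; last exact: depth_pivot.
by rewrite /depth; case: ex_minnP => k /eqP + _ k0; rewrite k0.
Qed.

Lemma depth_par u : u != pivot T -> depth u = (depth (par T j u)).+1.
Proof.
move=> ur; rewrite {1}/depth; case: ex_minnP => -[|k]; first by rewrite /= (negbTE ur).
rewrite iterSr => ku kmin; congr _.+1; rewrite /depth; case: ex_minnP => m mu mmin.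
apply/eqP; rewrite eqn_leq mmin // andbT -ltnS; apply: kmin.
by rewrite iterSr.
Qed.

(** The ancestors of u, from u up to the pivot, have pairwise distinct depths and are therefore
    distinct. This is why n is enough fuel. *)
Lemma depth_lt u : (depth u < n)%N.
Proof.
have dep_iter i : (i <= depth u)%N -> depth (iter i (par T j) u) = (depth u - i)%N.
  elim: i => [|i IH] iu; first by rewrite subn0.
  have IHi := IH (ltnW iu); rewrite iterS.
  have := @depth_par (iter i (par T j) u); rewrite IHi.
  have -> : iter i (par T j) u != pivot T by rewrite -depth0 IHi subn_eq0 -ltnNge.
  by move=> /(_ isT); lia.
pose f (i : 'I_(depth u).+1) := iter i (par T j) u.
have finj : injective f.
  move=> i i' /(congr1 depth).
  rewrite /f (dep_iter i (ltn_ord i)) (dep_iter i' (ltn_ord i')) => e.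
  by apply: val_inj => /=; have := ltn_ord i; have := ltn_ord i'; lia.
by have := leq_card f finj; rewrite !card_ord.
Qed.

(** Invariant of the recursion unfolded l levels below the pivot: shallower vertices have
    contributed their own terms, those at depth l still stand for their subtrees. *)
Lemma up_sum_levels (R : realType) (a : 'I_n -> nat -> R) c f l : (l <= f)%N ->
  up_sum T f j a (pivot T) c =
    \sum_(w | (depth w < l)%N) a w c + \sum_(w | depth w == l) up_sum T (f - l) j a w c.
Proof.
elim: l => [|l IH] lf.
  rewrite big_pred0 // add0r (eq_bigl (pred1 (pivot T))) ?big_pred1_eq ?subn0 //.
  by move=> u; rewrite depth0.
rewrite IH; last exact: ltnW.
have fl : (f - l = (f - l.+1).+1)%N by lia.
have lev : \sum_(w | depth w == l) up_sum T (f - l) j a w c =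
    \sum_(w | depth w == l) a w c +
    \sum_(w | depth w == l.+1) up_sum T (f - l.+1) j a w c.
  rewrite fl.
  under eq_bigr do rewrite /up_sum -/up_sum.
  rewrite big_split /=; congr (_ + _).
  rewrite (exchange_big_dep (fun w => depth w == l.+1)) /=; last first.
    by move=> u w /eqP ul /andP[wr /eqP pw]; rewrite depth_par // pw ul.
  apply: eq_bigr => w /eqP wl; rewrite (big_pred1 (par T j w)) // => u.
  have wr : w != pivot T by rewrite -depth0 wl.
  rewrite /child wr /=; apply/andP/eqP => [[_ /eqP<-]//|->]; split=> //.
  by have := depth_par wr; rewrite wl => -[->].
rewrite lev addrA; congr (_ + _).
rewrite [RHS](bigID (fun w => depth w == l)) /= addrC; congr (_ + _); apply: eq_bigl => w.
  by rewrite ltnS; case: eqP => [->|_]; rewrite ?leqnn ?andbF.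
by rewrite ltnS; case: ltngtP.
Qed.


Lemma up_sum_pivot (R : realType) (a : 'I_n -> nat -> R) c :
  up_sum T n j a (pivot T) c = \sum_w a w c.
Proof.
rewrite (up_sum_levels a c (leqnn n)) [X in _ + X]big_pred0; last first.
  by move=> w; rewrite ltn_eqF // depth_lt.
by rewrite addr0; apply: eq_bigl => w; rewrite depth_lt.
Qed.

Lemma down_val_pivot (R : realType) (z : nat -> R) f u c : (depth u <= f)%N ->
  down_val T f j z u c = z c.
Proof.
elim: f u => [|f IH] u /=; first by rewrite leqn0 depth0 => ->.
case: eqVneq => // ur; rewrite depth_par // ltnS; exact: IH.
Qed.

End TreeDepth.

Section AllReduceCorrect.
Variables (R : realType) (n : nat) (G : network n) (T : packing G).

Lemma block_size_gt0 d p : (0 < p)%N -> (0 < d)%N -> (0 < block_size d p)%N.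
Proof. by move=> p0 d0; rewrite /block_size divn_gt0 //; lia. Qed.

Lemma block_size_ge d p : (0 < p)%N -> (d <= p * block_size d p)%N.
Proof.
move=> p0; rewrite /block_size; have := ltn_ceil (d + p.-1) p0.
by rewrite mulSn mulnC; lia.
Qed.

Lemma block_size_le d p : (0 < p)%N -> (block_size d p * p <= d + p)%N.
Proof.
by move=> p0; apply: leq_trans (leq_trunc_div _ _) _; lia.
Qed.

(** Coordinate q < d sits at offset q mod m of block q / m, so the padding is never read; the block
    index is below [npk T] because the blocks together cover d coordinates. *)
Lemma allreduce_sum d (a : 'I_n -> 'rV[R]_d) u : allreduce T a u = \sum_i a i.
Proof.
apply/rowP => q; rewrite !mxE summxE /=.
have d0 : (0 < d)%N by case: (d) q => // -[].
have p0 := npk_gt0 T; have m0 := block_size_gt0 p0 d0.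
have jT : (q %/ block_size d (npk T) < npk T)%N.
  by rewrite ltn_divLR //; apply: leq_trans (ltn_ord q) (block_size_ge _ p0).
rewrite (@down_val_pivot _ _ _ _ jT) ?(ltnW (depth_lt jT u)) // (up_sum_pivot jT).
by apply: eq_bigr => i _; rewrite -divn_eq /padded valK.
Qed.

(** A link delays by one slot a stream that delivers one coordinate per slot, and does not slow it
    down. *)
Lemma leq_pipeline (ready : nat -> nat) b : (forall c, (ready c <= c + b)%N) ->
  forall c, (pipeline ready c <= c + b.+1)%N.
Proof.
move=> rb; elim=> [|c IH] /=; rewrite addnS ltnS geq_max rb //=.
by rewrite addSnnS.
Qed.

Lemma leq_up_ready f j u c : (up_ready T f j u c <= c + f)%N.
Proof.
elim: f u c => //= f IH u c; apply/bigmax_leqP => w _.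
by apply: leq_pipeline => c'; apply: IH.
Qed.

Lemma leq_down_ready f j s u c : (down_ready T f j s u c <= c + (s + f))%N.
Proof.
elim: f u c => [|f IH] u c /=; first by case: ifP; lia.
case: ifP => _; first by lia.
by rewrite addnS; apply: leq_pipeline => c'; apply: IH.
Qed.

(** With m the block size, the reduction ends by slot m + n, and the broadcast started at its end
    takes at most m + n more. *)
Lemma leq_allreduce_slots d :
  (allreduce_slots T d <= 2 * block_size d (npk T) + 2 * n)%N.
Proof.
rewrite /allreduce_slots; set m := block_size _ _.
apply/bigmax_leqP => j _; apply/bigmax_leqP => u _; apply/bigmax_leqP => c _.
set s := (\max_(c' < m) _)%N.
have : (s <= m + n)%N.
  apply/bigmax_leqP => c' _; apply: leq_trans (leq_up_ready _ _ _ _) _.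
  by rewrite leq_add2r ltnW.
by have := leq_down_ready n j s u c; have := ltn_ord c; lia.
Qed.

Lemma allreduce_time1 d : (n <= 1)%N -> allreduce_time R T d = 0.
Proof.
move=> n1; have all u : u = pivot T.
  by apply: val_inj => /=; have := ltn_ord u; have := ltn_ord (pivot T); lia.
have nochild j u w : child T j u w = false by rewrite /child (all w) eqxx.
have up f j u c : up_ready T f j u c = 0%N.
  by case: f => //= f; rewrite big_pred0.
rewrite /allreduce_time; suff -> : allreduce_slots T d = 0%N by rewrite mulr0.
apply/eqP; rewrite -leqn0 /allreduce_slots.
apply/bigmax_leqP => j _; apply/bigmax_leqP => u _; apply/bigmax_leqP => c _.
set s := (\max_(c' < _) _)%N.
have down f : down_ready T f j s u c = s by case: f => [|f] /=; rewrite (all u) eqxx.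
rewrite down.
by apply/bigmax_leqP => c' _; rewrite up.
Qed.

End AllReduceCorrect.

(** * Minimum cuts *)

Section MinCut.
Variables (R : realType) (n : nat) (G : network n).

Lemma connect_crossing (e : rel 'I_n) (W : {set 'I_n}) a b : connect e a b ->
  a \in W -> b \notin W -> exists i j, [/\ e i j, i \in W & j \notin W].
Proof.
case/connectP => p; elim: p a => [|c p IH] a /=; first by move=> _ -> ->.
move=> /andP[ac pp] bE aW bW; have [cW|cW] := boolP (c \in W); first exact: IH cW bW.
by exists a, c.
Qed.

Lemma nontrivial_sep (W : {set 'I_n}) : W != finset.set0 -> W != [set: 'I_n]%SET ->
  exists a b, a \in W /\ b \notin W.
Proof.
move=> /set0Pn[a aW]; rewrite -finset.subTset => /subsetPn[b _ bW].
by exists a, b.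
Qed.

Lemma mult_cut_gt0 (W : {set 'I_n}) : W != finset.set0 -> W != [set: 'I_n]%SET ->
  (0 < mult_cut G W)%N.
Proof.
move=> W0 WT; have [a [b [aW bW]]] := nontrivial_sep W0 WT.
have [i [j [ij iW jW]]] := connect_crossing (mult_connected G a b) aW bW.
rewrite /mult_cut (bigD1 i) //= (bigD1 j) ?inE //= -addnA.
exact: leq_trans ij (leq_addr _ _).
Qed.

Lemma cut_value_gt0 (W : {set 'I_n}) : W != finset.set0 -> W != [set: 'I_n]%SET ->
  0 < cut_value R G W.
Proof.
move=> W0 WT; rewrite cut_value_mult divr_gt0 ?ltr0n ?den_gt0 //.
exact: mult_cut_gt0.
Qed.

Lemma global_mincut_le (W : {set 'I_n}) : W != finset.set0 -> W != [set: 'I_n]%SET ->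
  (global_mincut R G <= (cut_value R G W)%:E)%E.
Proof.
move=> W0 WT.
by apply: (bigmin_le_cond _ (fun U : {set 'I_n} => (cut_value R G U)%:E)); rewrite W0.
Qed.

Lemma global_mincutP : (1 < n)%N -> exists W : {set 'I_n},
  [/\ W != finset.set0, W != [set: 'I_n]%SET &
    global_mincut R G = (cut_value R G W)%:E].
Proof.
move=> n1; pose r := Ordinal n1.
pose nontriv (W : {set 'I_n}) := (W != finset.set0) && (W != [set: 'I_n]%SET).
have nr : nontriv [set r]%SET.
  apply/andP; split; first by apply/set0Pn; exists r; rewrite inE.
  by apply/eqP => /setP/(_ (Ordinal (ltnW n1))); rewrite !inE.
pose W := [arg min_(W < [set r]%SET | nontriv W) cut_value R G W]%O.
have [/andP[W0 WT] Wmin] :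
    nontriv W /\ forall U, nontriv U -> cut_value R G W <= cut_value R G U.
  by rewrite /W; case: Order.TotalTheory.arg_minP.
exists W; split=> //; apply/le_anti; rewrite global_mincut_le //=.
by apply/bigmin_geP; split=> [|U /Wmin]; rewrite ?leey ?lee_fin.
Qed.

(** Some tree edge crosses any given cut, and its weight is a minimum cut between its ends;
    conversely every tree weight is the value of a cut. For n = 1 both minima are empty, hence
    infinite. *)
Lemma min_tree_weight_mincut (F : rel 'I_n) (w : 'I_n -> 'I_n -> R) :
  gomory_hu G F w -> min_tree_weight F w = global_mincut R G.
Proof.
case=> -[Fsym _ Fconn Fside] FW; apply/le_anti/andP; split.
  apply/bigmin_geP; split=> [|U /andP[U0 UT]]; first exact: leey.
  have [a [b [aU bU]]] := nontrivial_sep U0 UT.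
  have [i [j [ij iU jU]]] := connect_crossing (Fconn a b) aU bU.
  apply: (@le_trans _ _ (w i j)%:E).
    exact: (bigmin_le_cond _ (fun e : 'I_n * 'I_n => (w e.1 e.2)%:E) (j := (i, j))).
  by rewrite lee_fin; have [-> min] := FW _ _ ij; apply: min.
apply/bigmin_geP; split=> [|[i j] /= ij]; first exact: leey.
have [-> _] := FW _ _ ij; apply: global_mincut_le.
  by apply/set0Pn; exists i; rewrite inE connect0.
by apply/eqP => sT; have := Fside _ _ ij; rewrite sT inE.
Qed.

Variable T : packing G.

(** Write the 2m + 2n slots as 2(m - 1) + 2n + 2 and multiply by the integral cut value Dw.
    Near-optimality bounds Dw(m - 1) by kappa d; large dimension bounds Dwn, and so Dw, by d. The
    total is 2 kappa + 2 + 2. *)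
Lemma allreduce_time_bound (kappa : R) d : 0 < kappa ->
  near_optimal kappa T -> large_dim R G d ->
  ((allreduce_time R T d)%:E <=
   (2 * (kappa + 2))%:E * (d%:R%:E * (global_mincut R G)^-1))%E.
Proof.
move=> k0; have [n1|n1] := leqP n 1.
  rewrite allreduce_time1 // => _ _; apply: mule_ge0; first by rewrite lee_fin; lra.
  apply: mule_ge0; first by rewrite lee_fin.
  rewrite inve_ge0; apply/bigmin_geP; split=> [|U /andP[U0 UT]]; first exact: leey.
  by rewrite lee_fin ltW // cut_value_gt0.
move=> /(_ n1) + /(_ n1); rewrite /multi_mincut.
have [W [W0 WT ->]] := global_mincutP n1; have := cut_value_gt0 W0 WT.
move: (cut_value R G W) => w w0; rewrite inver gt_eqF // -!EFinM !lee_fin.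
have := leq_allreduce_slots T d; have := block_size_le d (npk_gt0 T).
rewrite /allreduce_time; move: (allreduce_slots T d) (block_size d (npk T)) => s m.
have := npk_gt0 T; have := den_gt0 G; move: (npk T) (den G) => p D.
rewrite -(ltr0n R) -(ltr0n R) -!(ler_nat R) !natrD !natrM.
have : 1 <= n%:R :> R by rewrite ler1n; lia.
move: s%:R m%:R p%:R D%:R d%:R n%:R => {}s {}m {}p {}D {}d N N1 D0 p0 mp sm opt big.
rewrite mulrA ler_pdivlMr //.
(* Rounding up costs at most one coordinate per block, so (m - 1)p <= d; for m <= 1 the left side is
   nonpositive. *)
have h1 : D * w * (m - 1) <= kappa * d.
  have [m1|m1] := leP m 1.
    have Dw : 0 <= D * w by rewrite mulr_ge0 // ltW.
    have NDw : 0 <= N * (D * w) by rewrite mulr_ge0 //; lra.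
    have : D * w * (m - 1) <= 0 by rewrite mulr_ge0_le0 // subr_le0.
    have : 0 <= kappa * d by rewrite mulr_ge0 ?(ltW k0) //; lra.
    by lra.
  have : (m - 1) * p <= d by lra.
  have : D * w * (m - 1) <= kappa * p * (m - 1) by rewrite ler_wpM2r //; lra.
  by nra.
have h2 : D * w <= N * (D * w) by rewrite ler_peMl // mulr_ge0 // ltW.
have h3 : D * s * w <= D * w * (2 * m + 2 * N).
  by rewrite mulrAC; apply: ler_wpM2l; [apply: mulr_ge0|]; lra.
apply: le_trans h3 _; have -> : D * w * (2 * m + 2 * N) =
  2 * (D * w * (m - 1)) + 2 * (N * (D * w)) + 2 * (D * w) by ring.
by lra.
Qed.

End MinCut.

Local Open Scope classical_set_scope.
Local Open Scope ring_scope.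

(** * Computation time *)

Section ComputeTime.
Variables (R : realType) (n : nat) (h : 'I_n -> R) (sigma eps : R).
Hypotheses (n0 : (0 < n)%N) (h0 : forall i, 0 < h i) (eps0 : 0 < eps).

Definition compute_scale : R :=
  Num.max (\big[Num.max/0]_i h i)
       (sigma ^+ 2 / (n%:R * eps) * (n%:R^-1 * \sum_i h i)).

Let hle i : h i <= compute_scale.
Proof. by rewrite /compute_scale le_max (le_bigmax_cond _ h). Qed.

Lemma compute_scale_gt0 : 0 < compute_scale.
Proof. exact: lt_le_trans (h0 (Ordinal n0)) (hle _). Qed.

Lemma mean_inv_batch_le (B : 'I_n -> nat) : enough sigma eps B ->
  n%:R^-1 * \sum_i (B i)%:R^-1 <=
    n%:R / Num.max (Num.ceil (sigma ^+ 2 / eps))%:~R n%:R :> R.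
Proof.
case=> B0; set m := Num.max _ _ => hB.
have n0' : 0 < n%:R :> R by rewrite ltr0n.
have m0 : 0 < m by rewrite lt_max n0' orbT.
have S0 : 0 < n%:R^-1 * \sum_i (B i)%:R^-1 :> R.
  rewrite mulr_gt0 ?invr_gt0 // (bigD1 (Ordinal n0)) //=.
  apply: ltr_pwDl; first by rewrite invr_gt0 ltr0n.
  by apply: sumr_ge0 => i _; rewrite invr_ge0.
by rewrite -[leLHS]invrK -[leRHS]invrK invf_div lef_pV2 ?posrE ?invr_gt0 ?divr_gt0.
Qed.

Lemma variance_bound (B : 'I_n -> nat) : enough sigma eps B ->
  \sum_i (n%:R * (B i)%:R)^-2 * ((B i)%:R * sigma ^+ 2) <= eps :> R.
Proof.
move=> eB; have := mean_inv_batch_le eB; set m := Num.max _ _ => hB.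
have n0' : 0 < n%:R :> R by rewrite ltr0n.
have m0 : 0 < m by rewrite lt_max n0' orbT.
have -> : \sum_i (n%:R * (B i)%:R)^-2 * ((B i)%:R * sigma ^+ 2) =
    sigma ^+ 2 / n%:R * (n%:R^-1 * \sum_i (B i)%:R^-1) :> R.
  rewrite !mulr_sumr; apply: eq_bigr => i _; have Bi0 : (B i)%:R != 0 :> R.
    by rewrite pnatr_eq0 -lt0n; case: eB.
  by field; rewrite Bi0 gt_eqF.
apply: le_trans (ler_wpM2l _ hB) _; first by rewrite divr_ge0 ?sqr_ge0.
have -> : sigma ^+ 2 / n%:R * (n%:R / m) = sigma ^+ 2 / m.
  by field; rewrite !gt_eqF.
rewrite ler_pdivrMr // mulrC -ler_pdivrMr //.
by rewrite /m le_max ceil_ge.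
Qed.

(** The 4 is a factor 2 for truncating t / h i, times 2 because the required size is bounded by two
    terms, sigma^2 / eps and n, each contributing one [compute_scale]. *)
Lemma enough_scale : enough sigma eps (batches h (4 * compute_scale)).
Proof.
have s0 := compute_scale_gt0; have n0' : 0 < n%:R :> R by rewrite ltr0n.
set t := 4 * _; have t0 : 0 < t by rewrite mulr_gt0.
(* A nonempty batch b satisfies t / h i < b + 1 <= 2b. *)
have B1 i : (0 < batches h t i)%N /\ (batches h t i)%:R^-1 <= 2 * h i / t.
  have x4 : 4 <= t / h i by rewrite ler_pdivlMr // ler_pM2l.
  have B0 : (0 < batches h t i)%N by rewrite /batches truncn_gt0; lra.
  split=> //; have := truncnS_gt (t / h i); rewrite -/(batches h t i) -natr1.
  have : 1 <= (batches h t i)%:R :> R by rewrite ler1n.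
  move: (batches h t i)%:R => b b1; rewrite ltr_pdivrMr // => tb.
  rewrite -[leLHS]mul1r ler_pdivrMr; last by lra.
  rewrite mulrAC ler_pdivlMr // mul1r; apply: ltW; apply: lt_le_trans tb _.
  by rewrite mulrAC; apply: ler_wpM2r; [exact: ltW|lra].
split=> [i|]; first by case: (B1 i).
set M := Num.max _ _.
have havg : n%:R^-1 * \sum_i h i <= compute_scale.
  rewrite mulrC ler_pdivrMr // mulr_natr -[X in _ *+ X]card_ord -sumr_const.
  by apply: ler_sum => i _.
have havg0 : 0 <= n%:R^-1 * \sum_i h i.
  by rewrite mulr_ge0 ?invr_ge0 // sumr_ge0 // => i _; apply: ltW.
(* The ceiling adds less than 1, which is at most n. *)
have ML : M <= sigma ^+ 2 / eps + n%:R.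
  have n1 : 1 <= n%:R :> R by rewrite ler1n.
  have s1 : 0 <= sigma ^+ 2 / eps by rewrite divr_ge0 ?sqr_ge0 // ltW.
  rewrite /M ge_max; apply/andP; split; last by lra.
  by have := ceilB1_lt (sigma ^+ 2 / eps); lra.
have M0 : 0 < M by rewrite lt_max n0' orbT.
have avgS : n%:R^-1 * \sum_i (batches h t i)%:R^-1 <= 2 / t * (n%:R^-1 * \sum_i h i) :> R.
  rewrite mulrCA; apply: ler_wpM2l; first by rewrite invr_ge0.
  rewrite mulr_sumr; apply: ler_sum => i _; rewrite mulrAC.
  by case: (B1 i).
have S0 : 0 < n%:R^-1 * \sum_i (batches h t i)%:R^-1 :> R.
  rewrite mulr_gt0 ?invr_gt0 // (bigD1 (Ordinal n0)) //=.
  apply: ltr_pwDl; first by rewrite invr_gt0 ltr0n; case: (B1 (Ordinal n0)).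
  by apply: sumr_ge0 => i _; rewrite invr_ge0.
rewrite -[leRHS]mul1r ler_pdivlMr // mulrAC ler_pdivrMr // mul1r.
have hv : sigma ^+ 2 / (n%:R * eps) * (n%:R^-1 * \sum_i h i) <= compute_scale.
  by rewrite /compute_scale le_max lexx orbT.
apply: (@le_trans _ _ ((sigma ^+ 2 / eps + n%:R) * (2 / t * (n%:R^-1 * \sum_i h i)))).
  by apply: ler_pM => //; exact: ltW.
have -> : (sigma ^+ 2 / eps + n%:R) * (2 / t * (n%:R^-1 * \sum_i h i)) =
    (2 * n%:R / t) * (sigma ^+ 2 / (n%:R * eps) * (n%:R^-1 * \sum_i h i) +
       (n%:R^-1 * \sum_i h i)).
  by field; rewrite !gt_eqF.
have nE : n%:R = (2 * n%:R / t) * (compute_scale + compute_scale) :> R.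
  by rewrite /t; field; rewrite gt_eqF.
rewrite [leRHS]nE.
by apply: ler_wpM2l; [rewrite divr_ge0 ?mulr_ge0 // ltW|exact: lerD].
Qed.

Definition compute_set := [set t : R | 0 <= t /\ enough sigma eps (batches h t)].

Lemma compute_set_inf : has_inf compute_set.
Proof.
split; last by exists 0 => t [].
exists (4 * compute_scale); split; last exact: enough_scale.
by rewrite mulr_ge0 // ltW // compute_scale_gt0.
Qed.

Lemma compute_time_ge0 : 0 <= compute_time h sigma eps.
Proof. by apply: lb_le_inf => [|t []//]; case: compute_set_inf. Qed.

Lemma compute_time_le : compute_time h sigma eps <= 4 * compute_scale.
Proof.
apply: ge_inf; first by case: compute_set_inf.
by split; [rewrite mulr_ge0 // ltW // compute_scale_gt0|exact: enough_scale].
Qed.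

(* The batch sizes are right-continuous in time, so the infimum is attained. *)
Lemma enough_compute_time : enough sigma eps (batches h (compute_time h sigma eps)).
Proof.
set t := compute_time _ _ _; have t0 : 0 <= t by apply: compute_time_ge0.
(* Time left at t until worker i finishes its next gradient. No batch changes before the smallest
   gap has elapsed, and the infimum is approached within it. *)
pose gap i := ((batches h t i).+1)%:R * h i - t.
have gap0 : 0 < \big[Num.min/1]_i gap i.
  apply/bigmin_gtP; split=> // i _; rewrite subr_gt0 -ltr_pdivrMr //.
  exact: truncnS_gt.
have [u [u0 eu] ut] := inf_adherent gap0 compute_set_inf.
have tu : t <= u by apply: ge_inf => //; case: compute_set_inf.
suff <- : batches h u = batches h t by [].
apply/funext => i; apply/eqP; rewrite /batches truncn_eq ?divr_ge0 ?(ltW (h0 i)) //.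
apply/andP; split.
  apply: (@le_trans _ _ (t / h i)); last by rewrite ler_pM2r // invr_gt0.
  by rewrite truncn_le divr_ge0 // ltW.
rewrite ltr_pdivrMr //; apply: (lt_le_trans ut).
rewrite -lerBrDl; exact: bigmin_le.
Qed.

End ComputeTime.

(** * Smoothness *)

Section Euclidean.
Variables (R : realType) (d : nat).
Implicit Types x y z : 'rV[R]_d.

Definition dotv x y : R := \sum_q x 0 q * y 0 q.

Lemma enorm_sqr x : enorm x ^+ 2 = dotv x x.
Proof.
rewrite sqr_sqrtr; first by apply: eq_bigr => q _; rewrite expr2.
by apply: sumr_ge0 => q _; apply: sqr_ge0.
Qed.

Lemma enorm_ge0 x : 0 <= enorm x.
Proof. exact: sqrtr_ge0. Qed.

Lemma dotvv_ge0 x : 0 <= dotv x x.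
Proof. by rewrite -enorm_sqr sqr_ge0. Qed.

Lemma dotvC x y : dotv x y = dotv y x.
Proof. by apply: eq_bigr => q _; rewrite mulrC. Qed.

Lemma dotvDl x y z : dotv (x + y) z = dotv x z + dotv y z.
Proof. by rewrite -big_split; apply: eq_bigr => q _; rewrite mxE mulrDl. Qed.

Lemma dotvZl (a : R) x z : dotv (a *: x) z = a * dotv x z.
Proof. by rewrite mulr_sumr; apply: eq_bigr => q _; rewrite mxE mulrA. Qed.

Lemma dotvDr x y z : dotv z (x + y) = dotv z x + dotv z y.
Proof. by rewrite dotvC dotvDl ![dotv _ z]dotvC. Qed.

Lemma dotvZr (a : R) x z : dotv z (a *: x) = a * dotv z x.
Proof. by rewrite dotvC dotvZl dotvC. Qed.

Lemma dotvNl x z : dotv (- x) z = - dotv x z.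
Proof. by rewrite -scaleN1r dotvZl mulN1r. Qed.

Lemma enormZ (a : R) x : enorm (a *: x) = `|a| * enorm x.
Proof.
rewrite /enorm -sqrtr_sqr -sqrtrM ?sqr_ge0 // mulr_sumr; congr Num.sqrt.
by apply: eq_bigr => q _; rewrite mxE exprMn.
Qed.

Lemma dotv0l x : dotv 0 x = 0.
Proof. by rewrite /dotv big1 // => q _; rewrite mxE mul0r. Qed.

Lemma enorm_eq0 x : enorm x = 0 -> x = 0.
Proof.
move=> x0; apply/rowP => q; rewrite mxE.
have /eqP : \sum_q x 0 q ^+ 2 = 0.
  rewrite -[LHS]sqr_sqrtr -/(enorm x) ?x0 ?expr0n //=.
  by apply: sumr_ge0 => q' _; apply: sqr_ge0.
rewrite psumr_eq0 => [/allP/(_ q)|q' _]; last exact: sqr_ge0.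
by rewrite mem_index_enum sqrf_eq0 => /(_ isT)/eqP.
Qed.

Lemma dotv_le x y : dotv x y <= enorm x * enorm y.
Proof.
have [/enorm_eq0 ->|x0] := eqVneq (enorm x) 0.
  by rewrite dotv0l mulr_ge0 ?enorm_ge0.
have [/enorm_eq0 ->|y0] := eqVneq (enorm y) 0.
  by rewrite dotvC dotv0l mulr_ge0 ?enorm_ge0.
have xp : 0 < enorm x by rewrite lt_neqAle eq_sym x0 enorm_ge0.
have yp : 0 < enorm y by rewrite lt_neqAle eq_sym y0 enorm_ge0.
(* This square equals 2ab(ab - dotv x y), where a and b are the two norms. *)
have := dotvv_ge0 (enorm y *: x - enorm x *: y).
rewrite -scaleNr dotvDl !dotvDr !dotvZl !dotvZr -!enorm_sqr (dotvC y x).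
move: (enorm x) (enorm y) xp yp (dotv x y) => a b a0 b0 c h.
have ab : 0 < a * b by rewrite mulr_gt0.
rewrite -(ler_pM2l ab); lra.
Qed.

End Euclidean.

Section Gradient.
Variables (R : realType) (d : nat).

Lemma derive_grad (f : 'rV[R]_d -> R) x v : differentiable f x ->
  'D_v f x = dotv (grad f x) v.
Proof.
move=> df; rewrite deriveE // {1}[v]row_sum_delta linear_sum /=.
by apply: eq_bigr => q _; rewrite linearZ /= mxE deriveE // mulrC.
Qed.

Lemma grad_favg n (f : 'I_n -> 'rV[R]_d -> R) x :
  (forall i x, differentiable (f i) x) ->
  grad (favg f) x = n%:R^-1 *: \sum_i grad (f i) x.
Proof.
move=> df; apply/rowP => q; rewrite !mxE summxE.
have der i : derivable (f i) x (delta_mx 0 q) by apply: diff_derivable.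
have -> : favg f = n%:R^-1 \*: (\sum_i f i).
  by apply/funext => y; rewrite /favg /= fct_sumE.
have dS : derivable (\sum_i f i) x (delta_mx 0 q) by apply: derivable_sum.
rewrite deriveZ //= derive_sum //; congr (_ * _).
by apply: eq_bigr => i _; rewrite mxE.
Qed.

(** The mean value theorem replaces integration of the gradient: the Lipschitz bound makes the
    derivative of [psi] nonpositive inside the unit interval, and psi 1 <= psi 0 is the claim. *)
Lemma descent (f : 'rV[R]_d -> R) L x y : L_smooth f L ->
  f y <= f x + dotv (grad f x) (y - x) + L / 2 * dotv (y - x) (y - x).
Proof.
case=> df Lf; set v := y - x; set c := dotv _ _; set N := dotv v v.
pose phi (t : R) := f (t *: v + x).
pose psi := phi - c \*: id - (L / 2 * N) \*: (id ^+ 2 : R -> R).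
have dphi (t : R) : is_derive t 1 phi (dotv (grad f (t *: v + x)) v).
  have E : (fun h => h^-1 *: ((phi \o shift t) (h *: (1 : R)) - phi t)) =
     (fun h => h^-1 *: ((f \o shift (t *: v + x)) (h *: v) - f (t *: v + x))).
    apply/funext => h /=; congr (_ *: (f _ - _)).
    by rewrite /= scalerDl addrA [_ *: 1]mulr1.
  apply: DeriveDef; first by rewrite /derivable E; apply: diff_derivable.
  by rewrite -derive_grad // /derive E.
have dpsi (t : R) : is_derive t 1 psi (dotv (grad f (t *: v + x)) v - c - L * N * t).
  apply: is_derive_eq; rewrite /=.
  by rewrite /GRing.scale /=; field.
have [|t t01] := @MVT R psi (fun t => dotv (grad f (t *: v + x)) v - c - L * N * t) 0 1 ltr01.
  by apply: derivable_within_continuous => t _; case: (dpsi t).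
move/itvP : t01 => t01.
rewrite /psi /phi !fctE /= => E.
have bound : dotv (grad f (t *: v + x)) v - c <= L * N * t.
  rewrite /c -dotvNl -dotvDl; apply: le_trans (dotv_le _ _) _.
  have t0 : 0 <= t by rewrite t01.
  have := Lf (t *: v + x) x; rewrite addrK enormZ (ger0_norm t0) => h.
  apply: le_trans (ler_wpM2r (enorm_ge0 v) h) _.
  have -> : L * (t * enorm v) * enorm v = L * N * t by rewrite /N -enorm_sqr; ring.
  exact: lexx.
have : f (1 *: v + x) = f y by rewrite scale1r /v subrK.
have : f (0 *: v + x) = f x by rewrite scale0r add0r.
move: E; rewrite /GRing.scale /=; move: bound.
move: (f (1 *: v + x)) (f (0 *: v + x)) => a b bnd E bx ay.
lra.
Qed.
End Gradient.

(** * Independence *)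

Section Cylinders.
Context (R : realType) (dO dX : measure_display) (Omega : measurableType dO)
  (Xi : measurableType dX) (P : probability Omega R) (I : eqType)
  (X : I -> {RV P >-> Xi}) (Q : pred I).

(** The pi-system generating the sigma-algebra of the samples indexed by Q. *)
Definition cylinders : set (set Omega) :=
  [set S | exists (J : seq I) (A : I -> set Xi), [/\ all Q J,
     forall t, measurable (A t) & S = \bigcap_(t in [set` J]) (X t @^-1` A t)]].

Lemma cylinders_setI : setI_closed cylinders.
Proof.
move=> _ _ [J1 [A1 [Q1 m1 ->]]] [J2 [A2 [Q2 m2 ->]]].
exists (J1 ++ J2), (fun t => (if t \in J1 then A1 t else setT) `&`
  (if t \in J2 then A2 t else setT)); split.
- by rewrite all_cat Q1.
- by move=> t; apply: measurableI; case: ifP.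
apply/seteqP; split=> om /=.
  move=> [h1 h2] t /=; rewrite mem_cat => _.
  by split; case: ifP => // tJ; [apply: h1|apply: h2].
move=> h; split=> t /= tJ; have /= := h t; rewrite mem_cat tJ ?orbT => /(_ isT) [].
  by [].
by [].
Qed.

Lemma cylinders_measurable : cylinders `<=` @measurable _ Omega.
Proof.
move=> _ [J [A [_ mA ->]]]; apply: fin_bigcap_measurable => [|t _]; first exact: finite_seq.
exact: measurable_funPTI.
Qed.

Lemma cylinders_sigma S : <<s cylinders >> S -> measurable S.
Proof.
move: S; apply: smallest_sub; first exact: sigma_algebra_measurable.
exact: cylinders_measurable.
Qed.

Lemma cylinder_RV t : Q t ->
  measurable_fun setT (X t : g_sigma_algebraType cylinders -> Xi).
Proof.
move=> Qt _ A mA; rewrite setTI; apply: sub_sigma_algebra.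
exists [:: t], (fun=> A); split=> //=; first by rewrite Qt.
apply/seteqP; split=> om.
  by move=> h s; rewrite /= inE => /eqP->.
by move=> h; apply: (h t); rewrite /= inE.
Qed.

Lemma cylinder_measurable d (T : measurableType d) (f : Omega -> T) :
  measurable_fun setT (f : g_sigma_algebraType cylinders -> T) ->
  measurable_fun setT f.
Proof. by move=> mf mT A mA; apply: cylinders_sigma; exact: mf. Qed.

Definition indep_event (B : set Omega) := forall (J : seq I) (A : I -> set Xi),
  uniq J -> all Q J -> (forall t, measurable (A t)) ->
  P (B `&` \bigcap_(t in [set` J]) (X t @^-1` A t)) =
  (P B * P (\bigcap_(t in [set` J]) (X t @^-1` A t)))%E.

(** As functions of S, both sides are finite measures; they agree on a pi-system, hence on the
    sigma-algebra it generates. *)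
Lemma indep_event_sigma B S : measurable B -> indep_event B -> <<s cylinders >> S ->
  P (S `&` B) = (P B * P S)%E.
Proof.
move=> mB iB; pose b : {nonneg R} := NngNum (fine_ge0 (measure_ge0 P B)).
have -> : P B = (b%:num)%:E by rewrite /= fineK ?fin_num_measure.
rewrite -[LHS]/(mrestr P mB S) -[RHS]/(mscale b P S).
apply: (@g_sigma_algebra_measure_unique _ _ _ cylinders _ (fun=> setT)) => //.
- exact: cylinders_measurable.
- move=> _; exists [::], (fun=> setT); split=> //.
  by apply/seteqP; split.
- exact: bigcup_const.
- exact: cylinders_setI.
- move=> A [J [F [QJ mF ->]]].
  (* Cylinders may repeat an index, whereas independence is stated for distinct ones. *)
  have EJ : [set` J] = [set` undup J] by apply/seteqP; split=> t /=; rewrite mem_undup.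
  rewrite EJ /= /mrestr setIC iB ?undup_uniq //; last first.
    by apply/allP => t; rewrite mem_undup; apply: (allP QJ).
  by rewrite /mscale /= fineK ?fin_num_measure.
- move=> _; rewrite /= /mrestr setTI.
  by apply: le_lt_trans (probability_le1 P mB) _; rewrite ltry.
Qed.

End Cylinders.

(** * Fubini and Tonelli for an independent pair *)

Section IndependentPair.
Context (R : realType) (dO d1 d2 : measure_display) (Omega : measurableType dO)
  (T1 : measurableType d1) (T2 : measurableType d2) (P : probability Omega R)
  (Y : {RV P >-> T1}) (W : {RV P >-> T2}) (D : probability T2 R).
Hypothesis lawW : forall A, measurable A -> distribution P W A = D A.
Hypothesis indYW : forall A B, measurable A -> measurable B ->
  P (Y @^-1` A `&` W @^-1` B) = (P (Y @^-1` A) * P (W @^-1` B))%E.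

Let YW (om : Omega) := (Y om, W om).
Let mYW : measurable_fun setT YW.
Proof. exact: measurable_fun_pair. Qed.
HB.instance Definition _ := isMeasurableFun.Build _ _ _ _ YW mYW.

Lemma joint_law S : measurable S ->
  (distribution P Y \x D)%E S = distribution P YW S.
Proof.
apply: product_measure_unique => A B mA mB.
transitivity (P (Y @^-1` A) * P (W @^-1` B))%E; last first.
  by congr (_ * _)%E; exact: lawW.
by rewrite -indYW.
Qed.

Lemma indep_tonelli (psi : T1 * T2 -> \bar R) : measurable_fun [set: T1 * T2] psi ->
  (forall z, 0 <= psi z)%E ->
  (\int[P]_om psi (Y om, W om) = \int[P]_om \int[D]_s psi (Y om, s))%E.
Proof.
move=> mpsi psi0.
transitivity (\int[distribution P YW]_z psi z)%E.
  by rewrite ge0_integral_distribution.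
transitivity (\int[distribution P Y \x D]_z psi z)%E.
  by apply: eq_measure_integral => S mS _; exact/esym/joint_law.
rewrite fubini_tonelli1 // ge0_integral_distribution //.
  exact: measurable_fun_fubini_tonelli_F.
by move=> y; apply: integral_ge0.
Qed.

(** Stands in for conditional expectation: Y will be the past, W a fresh sample, and psi averages to
    zero over the sample for every fixed past. *)
Lemma indep_fubini0 (psi : T1 * T2 -> R) : measurable_fun [set: T1 * T2] psi ->
  P.-integrable setT (EFin \o (fun om => psi (Y om, W om))) ->
  (forall y, \int[D]_s (psi (y, s))%:E = 0)%E ->
  (\int[P]_om (psi (Y om, W om))%:E = 0)%E.
Proof.
move=> mpsi ipsi psi0.
have mE : measurable_fun [set: T1 * T2] (EFin \o psi) by exact/measurable_EFinP.
transitivity (\int[distribution P YW]_z (psi z)%:E)%E.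
  by rewrite integral_distribution.
transitivity (\int[distribution P Y \x D]_z (psi z)%:E)%E.
  by apply: eq_measure_integral => S mS _; exact/esym/joint_law.
rewrite -(integral12_prod_meas1 (f := EFin \o psi)) /=.
  by apply: integral0_eq => y _; exact: psi0.
apply/integrableP; split=> //.
case/integrableP: ipsi => _; apply: le_lt_trans.
rewrite (eq_measure_integral (distribution P YW)); last first.
  by move=> S mS _; exact: joint_law.
rewrite ge0_integral_distribution //; exact: measurableT_comp.
Qed.

End IndependentPair.

(** Tonelli makes the section integrals of the positive and negative parts measurable. This serves
    to turn the gradients, as means of the oracle, into measurable functions. *)
Lemma measurable_mean (R : realType) d1 d2 (T1 : measurableType d1)
    (T2 : measurableType d2) (D : probability T2 R) (phi : T1 * T2 -> R) (m : T1 -> R) :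
  measurable_fun [set: T1 * T2] phi -> (forall y, \int[D]_s (phi (y, s))%:E = (m y)%:E)%E ->
  measurable_fun setT m.
Proof.
move=> mphi mE; apply/measurable_EFinP.
have mE' : measurable_fun [set: T1 * T2] (EFin \o phi) by exact/measurable_EFinP.
have -> : EFin \o m = (fun y => (\int[D]_s ((EFin \o phi)^\+)%E (y, s)) -
     \int[D]_s ((EFin \o phi)^\-)%E (y, s))%E.
  apply/funext => y; rewrite [LHS]/= -mE integralE.
  by congr (_ - _)%E; apply: eq_integral => s _; rewrite ?funeposE ?funenegE.
apply: emeasurable_funB.
  apply: (measurable_fun_fubini_tonelli_F ((EFin \o phi)^\+)%E) => [|z].
    exact: measurable_funepos.
  exact: funepos_ge0.
apply: (measurable_fun_fubini_tonelli_F ((EFin \o phi)^\-)%E) => [|z].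
  exact: measurable_funeneg.
exact: funeneg_ge0.
Qed.

(** * Integrable and square-integrable random variables *)

Section SquareIntegrable.
Context (R : realType) (dO : measure_display) (Omega : measurableType dO)
  (P : probability Omega R).
Implicit Types X Y : Omega -> R.

Definition intble X := P.-integrable setT (EFin \o X).
Definition mean X : R := \int[P]_om X om.
Definition sqintble X := measurable_fun setT X /\ intble (fun om => X om ^+ 2).

Lemma intble_le X Y : measurable_fun setT X -> intble Y ->
  (forall om, `|X om| <= Y om) -> intble X.
Proof.
move=> mX iY XY; apply: le_integrable iY => //; first exact/measurable_EFinP.
move=> om _ /=; rewrite lee_fin; apply: le_trans (XY om) _; exact: ler_norm.
Qed.

Lemma intble_cst c : intble (fun=> c).
Proof.
by apply: finite_measure_integrable_cst.
Qed.

Lemma intbleD X Y : intble X -> intble Y -> intble (fun om => X om + Y om).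
Proof. by move=> iX iY; have := integrableD measurableT iX iY. Qed.

Lemma intbleZ c X : intble X -> intble (fun om => c * X om).
Proof. by move=> iX; have := integrableZl measurableT c iX. Qed.

Lemma intble_sum (J : Type) (r : seq J) (Z : J -> Omega -> R) :
  (forall j, intble (Z j)) -> intble (fun om => \sum_(j <- r) Z j om).
Proof.
move=> iZ; elim: r => [|j r IH].
  by under eq_fun do rewrite big_nil; exact: intble_cst.
by under eq_fun do rewrite big_cons; apply: intbleD.
Qed.

Lemma meanD X Y : intble X -> intble Y ->
  mean (fun om => X om + Y om) = mean X + mean Y.
Proof. by move=> iX iY; rewrite /mean RintegralD. Qed.

Lemma meanZ c X : intble X -> mean (fun om => c * X om) = c * mean X.
Proof. by move=> iX; rewrite /mean RintegralZl. Qed.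

Lemma mean_cst c : mean (fun=> c) = c.
Proof. by rewrite /mean Rintegral_cst // [X in _ * fine X]probability_setT mulr1. Qed.

Lemma mean_sum (J : Type) (r : seq J) (Z : J -> Omega -> R) :
  (forall j, intble (Z j)) ->
  mean (fun om => \sum_(j <- r) Z j om) = \sum_(j <- r) mean (Z j).
Proof.
move=> iZ; elim: r => [|j r IH].
  by under eq_fun do rewrite big_nil; rewrite mean_cst big_nil.
under eq_fun do rewrite big_cons.
by rewrite big_cons -IH meanD //; exact: intble_sum.
Qed.

Lemma mean_le X Y : intble X -> intble Y -> (forall om, X om <= Y om) ->
  mean X <= mean Y.
Proof. by move=> iX iY XY; apply: le_Rintegral. Qed.

Lemma EFin_mean X : intble X -> (mean X)%:E = (\int[P]_om (X om)%:E)%E.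
Proof. by move=> iX; rewrite /mean /Rintegral fineK //; apply: integrable_fin_num. Qed.

Lemma intble_ge0 X : measurable_fun setT X -> (forall om, 0 <= X om) ->
  (\int[P]_om (X om)%:E < +oo)%E -> intble X.
Proof.
move=> mX X0 iX; apply/integrableP; split; first exact/measurable_EFinP.
by under eq_integral do rewrite /= ger0_norm //.
Qed.

Lemma sqintbleM X Y : sqintble X -> sqintble Y -> intble (fun om => X om * Y om).
Proof.
move=> [mX iX] [mY iY]; apply: intble_le (intbleD iX iY) _ => [|om].
  exact: measurable_funM.
by rewrite ler_norml; move: (X om) (Y om) => a b; apply/andP; split; nra.
Qed.

Lemma sqintble_cst c : sqintble (fun=> c).
Proof. by split; [exact: measurable_cst|exact: intble_cst]. Qed.

Lemma sqintble_intble X : sqintble X -> intble X.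
Proof.
move=> sX; have := sqintbleM sX (sqintble_cst 1).
by under eq_fun do rewrite mulr1.
Qed.

Lemma sqintbleD X Y : sqintble X -> sqintble Y -> sqintble (fun om => X om + Y om).
Proof.
move=> sX sY; have [mX iX] := sX; have [mY iY] := sY; split.
  exact: measurable_funD.
have -> : (fun om => (X om + Y om) ^+ 2) =
    (fun om => (X om ^+ 2 + Y om ^+ 2) + 2 * (X om * Y om)).
  by apply/funext => om; ring.
by apply: intbleD; [exact: intbleD|apply/intbleZ/sqintbleM].
Qed.

Lemma sqintbleZ c X : sqintble X -> sqintble (fun om => c * X om).
Proof.
move=> [mX iX]; split; first exact: measurable_funM.
by under eq_fun do rewrite exprMn; exact: intbleZ.
Qed.

End SquareIntegrable.

(** * Evaluation at a uniform random index *)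

Section UniformIndex.
Context (R : realType) (dO : measure_display) (Omega : measurableType dO)
  (P : probability Omega R) (K : nat) (tau : {RV P >-> nat}).
Hypotheses (K0 : (0 < K)%N) (unif : uniform_index K tau).

(** The K prescribed probabilities already add up to 1. *)
Lemma uniform_index_ae : P (~` (tau @^-1` `I_K)) = 0%E.
Proof.
have mk (A : set nat) : measurable (tau @^-1` A) by apply: measurable_funPTI.
rewrite probability_setC //.
have -> : tau @^-1` `I_K = \big[setU/set0]_(k < K) (tau @^-1` [set val k]).
  rewrite -(bigcup_mkord K (fun k => tau @^-1` [set k])).
  apply/seteqP; split=> om /=; first by exists (tau om).
  by move=> [k kK tk]; rewrite /= tk.
rewrite measure_bigsetU_ord //; last first.
  by apply/trivIsetP => i j _ _ ij; apply/seteqP; split=> // om /= [-> /val_inj/eqP];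
    rewrite (negbTE ij).
rewrite (eq_bigr (fun=> (K%:R^-1)%:E)); last by move=> k _; exact: unif (ltn_ord k).
have KV : K%:R^-1 *+ K = 1 :> R by rewrite -[LHS]mulr_natr mulVf // pnatr_eq0 -lt0n.
by rewrite sumEFin sumr_const card_ord KV subee.
Qed.

Lemma mean_at_index (k : nat) (h : Omega -> R) : (k < K)%N ->
  measurable_fun setT h -> (forall om, 0 <= h om) -> intble P h ->
  (forall A B, measurable A -> P (h @^-1` A `&` tau @^-1` B) =
     (P (h @^-1` A) * P (tau @^-1` B))%E) ->
  (\int[P]_om ((tau om == k)%:R * h om)%:E = (K%:R^-1 * mean P h)%:E)%E.
Proof.
move=> kK mh h0 ih ind.
pose Y : {mfun Omega >-> R} := HB.pack h (isMeasurableFun.Build _ _ _ _ h mh).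
(* The absolute value makes psi nonnegative everywhere, as Tonelli asks; it changes nothing on the
   values of h. *)
pose psi (z : R * nat) : \bar R := ((z.2 == k)%:R * `|z.1|)%:E.
have mpsi : measurable_fun [set: (R * nat)%type] psi.
  apply/measurable_EFinP; apply: measurable_funM.
    have mdisc : measurable_fun setT (fun m : nat => (m == k)%:R : R) by [].
    by apply: (measurableT_comp mdisc); exact: measurable_snd.
  by apply: measurableT_comp => //; exact: measurable_fst.
have psi0 z : (0 <= psi z)%E by rewrite lee_fin mulr_ge0.
transitivity (\int[P]_om psi (Y om, tau om))%E.
  by apply: eq_integral => om _; rewrite /psi /= ger0_norm.
rewrite (indep_tonelli (D := distribution P tau)) //; last first.
  by move=> A B mA _; exact: ind.
transitivity (\int[P]_om (K%:R^-1 * h om)%:E)%E; last first.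
  by rewrite -EFin_mean ?meanZ //; exact: intbleZ.
apply: eq_integral => om _; rewrite /psi /=.
transitivity (\int[distribution P tau]_s ((h om)%:E * (\1_[set k] s)%:E))%E.
  apply: eq_integral => s _; rewrite -EFinM mulrC ger0_norm // indicE.
  by have -> : (s \in [set k]) = (s == k) by apply/idP/eqP; rewrite in_setE.
by rewrite ge0_integralZl_EFin // integral_indic // setIT [X in (_ * X)%E]unif // -EFinM mulrC.
Qed.

Lemma mean_uniform_index (h : nat -> Omega -> R) :
  (forall k, measurable_fun setT (h k)) -> (forall k om, 0 <= h k om) ->
  (forall k, intble P (h k)) ->
  (forall k A B, measurable A -> P (h k @^-1` A `&` tau @^-1` B) =
     (P (h k @^-1` A) * P (tau @^-1` B))%E) ->
  (\int[P]_om (h (tau om) om)%:E = (K%:R^-1 * \sum_(k < K) mean P (h k))%:E)%E.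
Proof.
move=> mh h0 ih ind.
have mk (A : set nat) : measurable (tau @^-1` A) by apply: measurable_funPTI.
have mtau (k : nat) : measurable_fun setT (fun om => (tau om == k)%:R : R).
  have mdisc : measurable_fun setT (fun m : nat => (m == k)%:R : R) by [].
  by apply: (measurableT_comp mdisc).
have mF k : measurable_fun setT (fun om => ((tau om == k)%:R * h k om)%:E).
  by apply/measurable_EFinP; exact: measurable_funM.
transitivity (\int[P]_om (\sum_(k < K) ((tau om == k)%:R * h k om)%:E))%E; last first.
  rewrite ge0_integral_sum //; last first.
    by move=> k om _; rewrite lee_fin mulr_ge0.
  rewrite mulr_sumr -sumEFin; apply: eq_bigr => k _.
  exact: (mean_at_index (ltn_ord k) (mh k) (h0 k) (ih k) (ind k)).
apply: ge0_ae_eq_integral => //.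
- apply/measurable_EFinP => _ A mA; rewrite setTI.
  have -> : (fun om => h (tau om) om) @^-1` A =
      \bigcup_k (tau @^-1` [set k] `&` h k @^-1` A).
    by apply/seteqP; split=> om /=; [exists (tau om)|move=> [k _ [/= -> ?]]].
  apply: bigcupT_measurable => k; apply: measurableI => //.
  by rewrite -[X in measurable X]setTI; exact: mh.
- exact: emeasurable_sum.
- by move=> om _; rewrite lee_fin.
- by move=> om _; apply: sume_ge0 => k _; rewrite lee_fin mulr_ge0.
exists (~` (tau @^-1` `I_K)); split=> //; first exact: measurableC.
  exact: uniform_index_ae.
move=> om /= nE; apply: contra_not nE => /= tK _.
rewrite (bigD1 (Ordinal tK)) //= eqxx mul1r big1 ?adde0 // => k kt.
have : tau om != k by apply: contra kt => /eqP tk; apply/eqP/val_inj; rewrite /= tk.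
by move=> /negbTE->; rewrite mul0r.
Qed.

End UniformIndex.

(** * Stochastic gradient descent *)

Section RowTuple.
Variables (R : realType) (d : nat).

(** The oracle's measurability is stated for the product sigma-algebra on tuples; this map and the
    next translate to and from vectors. *)
Definition row_of (y : d.-tuple R) : 'rV[R]_d := \row_r tnth y r.
Definition tuple_of (x : 'rV[R]_d) : d.-tuple R := [tuple x 0 r | r < d].

Lemma tuple_ofK : cancel tuple_of row_of.
Proof. by move=> x; apply/rowP => r; rewrite mxE tnth_mktuple. Qed.

Lemma measurable_tuple_of d' (T : measurableType d') (v : T -> 'rV[R]_d) :
  (forall q, measurable_fun setT (fun om => v om 0 q)) ->
  measurable_fun setT (fun om => tuple_of (v om)).
Proof.
move=> mv; apply/measurable_fun_tnthP => q.
rewrite (_ : _ \o _ = fun om => v om 0 q) //.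
by apply/funext => om /=; rewrite tnth_mktuple.
Qed.

End RowTuple.

Section Noise.
Context (R : realType) (n d : nat) (dX : measure_display)
    (Xi : measurableType dX) (D : 'I_n -> probability Xi R)
    (f : 'I_n -> 'rV[R]_d -> R) (g : 'I_n -> 'rV[R]_d -> Xi -> 'rV[R]_d)
    (sigma : R).
Hypothesis oracle : stochastic_oracle D f g sigma.

Definition noise i (x : 'rV[R]_d) (s : Xi) : 'rV[R]_d := g i x s - grad (f i) x.

Lemma measurable_grad i q :
  measurable_fun setT (fun y : d.-tuple R => grad (f i) (row_of y) 0 q).
Proof.
have [_ mg gE _] := oracle; apply: (measurable_mean (D := D i) (mg i q)) => y.
by have := gE i (row_of y) q; rewrite unlock.
Qed.

Lemma measurable_noise i q : measurable_fun [set: (d.-tuple R * Xi)%type]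
  (fun z : d.-tuple R * Xi => noise i (row_of z.1) z.2 0 q).
Proof.
have [_ mg _ _] := oracle.
rewrite (_ : (fun _ => _) = (fun z : d.-tuple R * Xi => g i (row_of z.1) z.2 0 q -
    grad (f i) (row_of z.1) 0 q)); last first.
  by apply/funext => z; rewrite !mxE.
apply: measurable_funB; first exact: mg.
by apply: (measurableT_comp (measurable_grad i q)); exact: measurable_fst.
Qed.

Lemma measurable_noise2 i q x : measurable_fun setT (fun s => noise i x s 0 q).
Proof.
have := measurable_fun_pair2 (tuple_of x) (measurable_noise i q).
by rewrite /= tuple_ofK.
Qed.

Lemma noise_variance i x :
  (\int[D i]_s (dotv (noise i x s) (noise i x s))%:E <= (sigma ^+ 2)%:E)%E.
Proof.
have [_ _ _ gV] := oracle; have := gV i x; rewrite unlock.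
by under eq_integral do rewrite enorm_sqr.
Qed.

Lemma dotv_ge_sqr (x : 'rV[R]_d) q : x 0 q ^+ 2 <= dotv x x.
Proof.
rewrite /dotv (bigD1 q) //= -expr2 lerDl sumr_ge0 // => r _.
by rewrite -expr2 sqr_ge0.
Qed.

Lemma sqintble_noise i x q : sqintble (D i) (fun s => noise i x s 0 q).
Proof.
have mn := measurable_noise2 i q x; split=> //.
apply: intble_ge0 => [||]; first exact: measurable_funX.
  by move=> s; apply: sqr_ge0.
apply: (@le_lt_trans _ _ (sigma ^+ 2)%:E); last exact: ltry.
apply: le_trans (noise_variance i x); apply: ge0_le_integral => //.
- by move=> s _; rewrite lee_fin sqr_ge0.
- by apply/measurable_EFinP; exact: measurable_funX.
- apply/measurable_EFinP; apply: measurable_sum => r.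
  by apply: measurable_funM; exact: measurable_noise2.
- by move=> s _; rewrite lee_fin dotv_ge_sqr.
Qed.

Lemma noise_mean0 i x q : (\int[D i]_s (noise i x s 0 q)%:E = 0)%E.
Proof.
have iN := sqintble_intble (sqintble_noise i x q).
have [_ _ gE _] := oracle; have := gE i x q; rewrite unlock => gq.
have iG : intble (D i) (fun s => g i x s 0 q).
  have := intbleD iN (intble_cst (D i) (grad (f i) x 0 q)).
  by under eq_fun do rewrite !mxE subrK.
rewrite -EFin_mean //; congr _%:E.
have -> : (fun s => noise i x s 0 q) = (fun s => g i x s 0 q + (- grad (f i) x 0 q)).
  by apply/funext => s; rewrite !mxE.
rewrite meanD ?mean_cst //; last exact: intble_cst.
apply/eqP; rewrite subr_eq0 -eqe EFin_mean //; exact/eqP.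
Qed.

End Noise.

(** * Stochastic gradient descent with weighted batches of samples *)

Section Process.
Context (R : realType) (n d : nat) (dX : measure_display)
    (Xi : measurableType dX) (D : 'I_n -> probability Xi R)
    (f : 'I_n -> 'rV[R]_d -> R) (g : 'I_n -> 'rV[R]_d -> Xi -> 'rV[R]_d)
    (sigma : R).
Hypothesis oracle : stochastic_oracle D f g sigma.
Variables (x0 : 'rV[R]_d) (gamma : R) (a : nat * 'I_n * nat -> R)
  (batch : nat -> seq (nat * 'I_n * nat)).
Hypothesis batch_iter : forall k t, t \in batch k -> t.1.1 = k.
Hypothesis batch_uniq : forall k, uniq (batch k).

Notation sample_id := (nat * 'I_n * nat)%type.

(** Summing over an arbitrary list lets second moments be computed one sample at a time. *)
Definition total_noise (J : seq sample_id) x (s : sample_id -> Xi) : 'rV[R]_d :=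
  \sum_(t <- J) a t *: noise f g t.1.2 x (s t).

Fixpoint sgd (s : sample_id -> Xi) (k : nat) : 'rV[R]_d :=
  if k is k'.+1 then
    sgd s k' - gamma *: (grad (favg f) (sgd s k') + total_noise (batch k') (sgd s k') s)
  else x0.

Section Measurability.
Context (dO : measure_display) (Omega : measurableType dO) (S : sample_id -> Omega -> Xi).

Lemma measurable_favg_grad (v : Omega -> 'rV[R]_d) q :
  (forall r, measurable_fun setT (fun om => v om 0 r)) ->
  measurable_fun setT (fun om => grad (favg f) (v om) 0 q).
Proof.
move=> mv; have [df _ _ _] := oracle.
rewrite (_ : (fun _ => _) = fun om => n%:R^-1 * \sum_i grad (f i) (v om) 0 q).
  apply: measurable_funM => //; apply: measurable_sum => i.
  rewrite (_ : (fun _ => _) =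
      (fun y => grad (f i) (row_of y) 0 q) \o (fun om => tuple_of (v om))).
    exact: measurableT_comp (measurable_grad oracle i q) (measurable_tuple_of mv).
  by apply/funext => om /=; rewrite tuple_ofK.
by apply/funext => om; rewrite grad_favg // !mxE summxE.
Qed.

Lemma measurable_noise_comp (v : Omega -> 'rV[R]_d) (W : Omega -> Xi) i q :
  (forall r, measurable_fun setT (fun om => v om 0 r)) -> measurable_fun setT W ->
  measurable_fun setT (fun om => noise f g i (v om) (W om) 0 q).
Proof.
move=> mv mW; rewrite (_ : (fun _ => _) =
    (fun z : d.-tuple R * Xi => noise f g i (row_of z.1) z.2 0 q) \o
    (fun om => (tuple_of (v om), W om))).
  exact: measurableT_comp (measurable_noise oracle i q)
    (measurable_fun_pair (measurable_tuple_of mv) mW).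
by apply/funext => om /=; rewrite tuple_ofK.
Qed.

Lemma measurable_total_noise (v : Omega -> 'rV[R]_d) (J : seq sample_id) q :
  (forall r, measurable_fun setT (fun om => v om 0 r)) ->
  (forall t, t \in J -> measurable_fun setT (S t)) ->
  measurable_fun setT (fun om => total_noise J (v om) (fun t => S t om) 0 q).
Proof.
move=> mv; rewrite /total_noise; elim: J => [|t J IH] mS.
  by under eq_fun do rewrite big_nil mxE; exact: measurable_cst.
under eq_fun do rewrite big_cons mxE [X in X + _]mxE.
apply: measurable_funD.
  apply: measurable_funM => //.
  by apply: measurable_noise_comp => //; apply: mS; rewrite mem_head.
by apply: IH => s sJ; apply: mS; rewrite inE sJ orbT.
Qed.

(** The sigma-algebra on [Omega] is left arbitrary: the lemma serves for the ambient one and for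
    that of the past, in which only some samples are measurable. *)
Lemma measurable_sgd k : (forall t, (t.1.1 < k)%N -> measurable_fun setT (S t)) ->
  forall q, measurable_fun setT (fun om => sgd (fun t => S t om) k 0 q).
Proof.
elim: k => [|k IH] mS q /=; first exact: measurable_cst.
have {}IH := IH (fun t tk => mS t (ltnW tk)).
under eq_fun do rewrite mxE [X in _ + X]mxE [X in _ - X]mxE [X in _ * X]mxE.
apply: measurable_funB => //; apply: measurable_funM => //.
apply: measurable_funD; first exact: measurable_favg_grad.
by apply: measurable_total_noise => // t /batch_iter tk; apply: mS; rewrite tk.
Qed.

End Measurability.

Section Moments.
Context (dO : measure_display) (Omega : measurableType dO) (P : probability Omega R)
  (xi : sample_id -> {RV P >-> Xi}).
Hypothesis iid : iid_samples D xi.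

Definition iterate k om := sgd (fun t => xi t om) k.
Definition sample_noise k t om := noise f g t.1.2 (iterate k om) (xi t om).
Definition partial_noise k (J : seq sample_id) om :=
  total_noise J (iterate k om) (fun t => xi t om).

Lemma iterate_measurable k q : measurable_fun setT (fun om => iterate k om 0 q).
Proof. by apply: (measurable_sgd (S := fun t => xi t)). Qed.

Lemma sample_noise_measurable k t q :
  measurable_fun setT (fun om => sample_noise k t om 0 q).
Proof.
by apply: (measurable_noise_comp (W := xi t)) => // r; exact: iterate_measurable.
Qed.

(** Since t is not among the indices in Q, it can be added to the list with event A; the two product
    formulas then differ by one factor. *)
Lemma indep_sample (Q : pred sample_id) t A : ~~ Q t -> measurable A ->
  indep_event xi Q (xi t @^-1` A).
Proof.
move=> Qt mA J F uJ QJ mF; have [_ ind] := iid.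
have tJ : t \notin J by apply: contra Qt => /(allP QJ).
pose F' s := if s == t then A else F s.
have F'J : forall s, s \in J -> F' s = F s.
  by move=> s sJ; rewrite /F'; case: eqP => // st; rewrite -st sJ in tJ.
have mF' s : measurable (F' s) by rewrite /F'; case: ifP.
have := ind (t :: J) F'; rewrite /= tJ uJ => /(_ isT mF').
have F't : F' t = A by rewrite /F' eqxx.
rewrite big_cons EFinM F't fineK ?fin_num_measure // => [|]; last first.
  exact: measurable_funPTI.
have -> : (\prod_(s <- J) fine (P (xi s @^-1` F' s)))%:E =
    P (\bigcap_(s in [set` J]) xi s @^-1` F s).
  rewrite ind //; congr _%:E; apply: eq_big_seq => s sJ.
  by rewrite F'J.
move=> <-; congr (P _); apply/seteqP; split=> om /=.
  move=> [omA h] s /=; rewrite /F' inE; case: eqP => [->|_] //= sJ.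
  exact: h.
move=> h; split; first by have := h t; rewrite /= mem_head /F' eqxx => /(_ isT).
by move=> s /= sJ; rewrite -F'J //; apply: h; rewrite /= inE sJ orbT.
Qed.

Section FreshSample.
Variables (Q : pred sample_id) (t : sample_id).
Hypotheses (Qt : ~~ Q t) (Qpast : forall s, (s.1.1 < t.1.1)%N -> Q s).

Notation past := (g_sigma_algebraType (cylinders xi Q)).

Lemma past_iter q : measurable_fun setT
  ((fun om => iterate t.1.1 om 0 q) : past -> R).
Proof.
apply: (measurable_sgd (S := fun s => xi s : past -> Xi)) => s st.
by apply: cylinder_RV; exact: Qpast.
Qed.

Lemma past_indep d1 (T1 : measurableType d1) (Y : Omega -> T1) A B :
  measurable_fun setT (Y : past -> T1) -> measurable A -> measurable B ->
  P (Y @^-1` A `&` xi t @^-1` B) = (P (Y @^-1` A) * P (xi t @^-1` B))%E.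
Proof.
move=> mY mA mB; rewrite muleC; apply: (@indep_event_sigma _ _ _ _ _ _ _ xi Q).
- exact: measurable_funPTI.
- exact: indep_sample.
- by have := mY measurableT _ mA; rewrite setTI.
Qed.

(** The pair formed by the current iterate and U is measurable for the samples in Q, of which sample
    t is independent. Q may also contain other samples of the iteration of t. *)
Lemma fresh_noise_mean0 (U : Omega -> R) q :
  measurable_fun setT (U : past -> R) ->
  intble P (fun om => U om * sample_noise t.1.1 t om 0 q) ->
  mean P (fun om => U om * sample_noise t.1.1 t om 0 q) = 0.
Proof.
move=> mU iU.
pose Yf om := (tuple_of (iterate t.1.1 om), U om).
have mY : measurable_fun setT (Yf : past -> (d.-tuple R * R)%type).
  apply: measurable_fun_pair mU; apply: measurable_tuple_of => q'.
  exact: past_iter.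
have mY' : measurable_fun setT Yf by exact: cylinder_measurable mY.
pose Y : {mfun Omega >-> (d.-tuple R * R)%type} :=
  HB.pack Yf (isMeasurableFun.Build _ _ _ _ Yf mY').
pose psi (z : (d.-tuple R * R) * Xi) : R :=
  z.1.2 * noise f g t.1.2 (row_of z.1.1) z.2 0 q.
have psiE om : psi (Y om, xi t om) = U om * sample_noise t.1.1 t om 0 q.
  by rewrite /psi /= tuple_ofK.
have lawW A : measurable A -> distribution P (xi t) A = D t.1.2 A.
  by case: iid => + _; case: (t) => -[k i] j; apply.
apply/EFin_inj; rewrite EFin_mean //.
under eq_integral do rewrite -psiE.
apply: (indep_fubini0 (Y := Y) (W := xi t) lawW).
- by move=> A B mA mB; exact: past_indep.
- apply: measurable_funM.
    by apply: (measurableT_comp measurable_snd); exact: measurable_fst.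
  apply: (measurable_noise_comp (v := fun z : (d.-tuple R * R) * Xi => row_of z.1.1)
    (W := snd)) => [r|]; last exact: measurable_snd.
  rewrite (_ : (fun _ => _) = (fun z : (d.-tuple R * R) * Xi => tnth z.1.1 r)); last first.
    by apply/funext => z; rewrite mxE.
  apply: (measurableT_comp (measurable_tnth r)).
  by apply: (measurableT_comp measurable_fst); exact: measurable_fst.
- by under eq_fun do rewrite psiE.
- move=> [y u]; rewrite /psi /=.
  have iN := sqintble_intble (sqintble_noise oracle t.1.2 (row_of y) q).
  rewrite -EFin_mean; last exact: intbleZ.
  rewrite meanZ // EFinM EFin_mean //.
  by rewrite (noise_mean0 oracle) mule0.
Qed.

End FreshSample.

(** The oracle bounds the variance at every fixed point; Tonelli carries the bound over to the
    random iterate. *)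
Lemma sample_noise_variance t :
  (\int[P]_om (dotv (sample_noise t.1.1 t om) (sample_noise t.1.1 t om))%:E
     <= (sigma ^+ 2)%:E)%E.
Proof.
pose Q := [pred s : sample_id | (s.1.1 < t.1.1)%N].
have Qt : ~~ Q t by rewrite /= ltnn.
have mY : measurable_fun setT
    ((fun om => tuple_of (iterate t.1.1 om)) : g_sigma_algebraType (cylinders xi Q) -> d.-tuple R).
  by apply: measurable_tuple_of => q'; apply: past_iter.
have mY' : measurable_fun setT (fun om => tuple_of (iterate t.1.1 om)).
  exact: cylinder_measurable mY.
pose Y : {mfun Omega >-> d.-tuple R} :=
  HB.pack (fun om => tuple_of (iterate t.1.1 om)) (isMeasurableFun.Build _ _ _ _ _ mY').
pose psi (z : d.-tuple R * Xi) : \bar R :=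
  (dotv (noise f g t.1.2 (row_of z.1) z.2) (noise f g t.1.2 (row_of z.1) z.2))%:E.
have psiE om : psi (Y om, xi t om) =
    (dotv (sample_noise t.1.1 t om) (sample_noise t.1.1 t om))%:E.
  by rewrite /psi /= tuple_ofK.
have lawW A : measurable A -> distribution P (xi t) A = D t.1.2 A.
  by case: iid => + _; case: (t) => -[k i] j; apply.
under eq_integral do rewrite -psiE.
have mpsi : measurable_fun [set: (d.-tuple R * Xi)%type] psi.
  apply/measurable_EFinP; apply: measurable_sum => q.
  by apply: measurable_funM; exact: (measurable_noise oracle).
have psi0 z : (0 <= psi z)%E by rewrite lee_fin dotvv_ge0.
rewrite (indep_tonelli (D := D t.1.2)) //; last first.
  by move=> A B mA mB; exact: (past_indep Qt).
apply: (@le_trans _ _ (\int[P]_om (cst (sigma ^+ 2)%:E om))%E); last first.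
  by rewrite integral_cst // [X in (_ * X)%E]probability_setT mule1.
apply: ge0_le_integral => //.
- by move=> om _; apply: integral_ge0.
- exact: measurableT_comp (measurable_fun_fubini_tonelli_F psi mpsi psi0) mY'.
- by move=> om _; exact: (noise_variance oracle t.1.2 (row_of (Y om))).
Qed.

Lemma sample_noise_sqintble t q :
  sqintble P (fun om => sample_noise t.1.1 t om 0 q).
Proof.
have mZ := sample_noise_measurable t.1.1 t q; split=> //.
apply: intble_ge0; first exact: measurable_funX.
  by move=> om; apply: sqr_ge0.
apply: (@le_lt_trans _ _ (sigma ^+ 2)%:E); last exact: ltry.
apply: le_trans (sample_noise_variance t); apply: ge0_le_integral => //.
- by move=> s _; rewrite lee_fin sqr_ge0.
- by apply/measurable_EFinP; exact: measurable_funX.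
- apply/measurable_EFinP; apply: measurable_sum => r.
  by apply: measurable_funM; exact: sample_noise_measurable.
- by move=> s _; rewrite lee_fin dotv_ge_sqr.
Qed.

Lemma sample_noise_second_moment t :
  \sum_q mean P (fun om => sample_noise t.1.1 t om 0 q ^+ 2) <= sigma ^+ 2.
Proof.
have iZ q : intble P (fun om => sample_noise t.1.1 t om 0 q ^+ 2).
  by case: (sample_noise_sqintble t q).
rewrite -mean_sum // -lee_fin EFin_mean; last exact: intble_sum.
apply: le_trans (sample_noise_variance t).
by under eq_integral do under eq_bigr do rewrite expr2.
Qed.

(** Noises of one batch share the random point x^k, so they are not independent; they are
    nevertheless orthogonal, which makes second moments additive. *)
Lemma partial_noise_moment k (J : seq sample_id) q : uniq J ->
  (forall t, t \in J -> t.1.1 = k) ->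
  sqintble P (fun om => partial_noise k J om 0 q) /\
  mean P (fun om => partial_noise k J om 0 q ^+ 2) =
    \sum_(t <- J) a t ^+ 2 * mean P (fun om => sample_noise t.1.1 t om 0 q ^+ 2).
Proof.
elim: J => [|t J IH] /= => [_ _|/andP[tJ uJ] Jk].
  have -> : (fun om => partial_noise k [::] om 0 q) = (fun=> 0).
    by apply/funext => om; rewrite /partial_noise /total_noise big_nil mxE.
  split; first exact: sqintble_cst.
  by rewrite big_nil; under eq_fun do rewrite /partial_noise /total_noise big_nil mxE expr0n;
    rewrite mean_cst.
have tk : t.1.1 = k by apply: Jk; rewrite mem_head.
have Jk' s : s \in J -> s.1.1 = k by move=> sJ; apply: Jk; rewrite inE sJ orbT.
have [sJ mJ] := IH uJ Jk'.
have sZ : sqintble P (fun om => sample_noise k t om 0 q).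
  by rewrite -tk; exact: sample_noise_sqintble.
have pE om : partial_noise k (t :: J) om 0 q =
    a t * sample_noise k t om 0 q + partial_noise k J om 0 q.
  by rewrite /partial_noise /total_noise big_cons !mxE.
have -> : (fun om => partial_noise k (t :: J) om 0 q) =
    (fun om => a t * sample_noise k t om 0 q + partial_noise k J om 0 q).
  by apply/funext => om; exact: pE.
split; first by apply: sqintbleD => //; exact: sqintbleZ.
have -> : (fun om => partial_noise k (t :: J) om 0 q ^+ 2) =
    (fun om => a t ^+ 2 * sample_noise k t om 0 q ^+ 2 +
      (2 * a t * (partial_noise k J om 0 q * sample_noise k t om 0 q) +
       partial_noise k J om 0 q ^+ 2)).
  by apply/funext => om; rewrite pE; ring.
have iX : intble P (fun om => partial_noise k J om 0 q * sample_noise k t om 0 q).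
  exact: sqintbleM.
have [mZ iZ] := sZ; have [mN iN] := sJ.
rewrite meanD; [|exact: intbleZ|by apply: intbleD => //; exact: intbleZ].
rewrite meanZ // meanD //; last exact: intbleZ.
rewrite meanZ // big_cons tk -mJ; congr (_ + _).
(* The samples of J join the past, so that the noise already summed is measurable for it while t
   remains fresh. *)
pose Q := [pred s : sample_id | (s.1.1 < k)%N || (s \in J)].
rewrite -tk (@fresh_noise_mean0 Q) ?mulr0 ?add0r ?tk //.
- by rewrite /= tk ltnn (negbTE tJ).
- by move=> s /= ->.
apply: (measurable_total_noise (S := fun s => xi s : g_sigma_algebraType (cylinders xi Q) -> Xi)).
  by move=> r; rewrite -tk; apply: past_iter => s; rewrite tk /= => ->.
by move=> s sJ'; apply: cylinder_RV; rewrite /= sJ' orbT.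
Qed.

Lemma total_noise_second_moment k :
  \sum_q mean P (fun om => partial_noise k (batch k) om 0 q ^+ 2) <=
  \sum_(t <- batch k) a t ^+ 2 * sigma ^+ 2.
Proof.
have E q := (@partial_noise_moment k (batch k) q (batch_uniq k) (@batch_iter k)).2.
under eq_bigr do rewrite E.
rewrite exchange_big /=; apply: ler_sum => t _.
rewrite -mulr_sumr; apply: ler_wpM2l; first exact: sqr_ge0.
exact: sample_noise_second_moment.
Qed.


(** * Descent along paths and stationarity in expectation *)

Section Descent.
Variables (L fstar : R).
Hypotheses (L0 : 0 < L) (smooth : L_smooth (favg f) L)
  (fmin : forall x, fstar <= favg f x) (gammaE : gamma = (2 * L)^-1).

Notation grad_at k om := (grad (favg f) (iterate k om)).

Lemma grad_measurable k q : measurable_fun setT (fun om => grad_at k om 0 q).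
Proof. by apply: measurable_favg_grad => r; exact: iterate_measurable. Qed.

(** By the Lipschitz bound, the square of a gradient coordinate at x^k is at most 2 L^2 |x^k -
    x^0|^2 plus twice its square at x^0. *)
Lemma grad_sqintble k : (forall q, sqintble P (fun om => iterate k om 0 q)) ->
  forall q, sqintble P (fun om => grad_at k om 0 q).
Proof.
move=> sx q; have mG := grad_measurable k q; split=> //.
pose c := 2 * grad (favg f) x0 0 q ^+ 2.
pose Y om := 2 * L ^+ 2 * (\sum_r (iterate k om 0 r + (- x0 0 r)) ^+ 2) + c.
have iY : intble P Y.
  apply: intbleD; last exact: intble_cst.
  apply: intbleZ; apply: intble_sum => r.
  by case: (sqintbleD (sx r) (sqintble_cst P (- x0 0 r))).
apply: intble_le iY _; first exact: measurable_funX.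
move=> om; rewrite ger0_norm ?sqr_ge0 //.
have [_ lip] := smooth; have := lip (iterate k om) x0.
rewrite -ler_sqr ?nnegrE ?mulr_ge0 ?enorm_ge0 ?(ltW L0) // exprMn !enorm_sqr.
have sqB (u v : 'rV[R]_d) : (u 0 q - v 0 q) ^+ 2 <= dotv (u - v) (u - v).
  by have := dotv_ge_sqr (u - v) q; rewrite !mxE.
have := sqB (grad_at k om) (grad (favg f) x0).
have -> : dotv (iterate k om - x0) (iterate k om - x0) = \sum_r (iterate k om 0 r + - x0 0 r) ^+ 2.
  by apply: eq_bigr => r _; rewrite !mxE expr2.
rewrite /Y /c; move: (dotv _ _) (\sum_r _) (grad_at k om 0 q) (grad _ x0 0 q).
move=> u v x y h1 h2; have := sqr_ge0 (x - 2 * y); lra.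
Qed.

Lemma iterate_sqintble k q : sqintble P (fun om => iterate k om 0 q).
Proof.
elim: k q => [|k IH] q; first exact: sqintble_cst.
have -> : (fun om => iterate k.+1 om 0 q) = (fun om => iterate k om 0 q +
    - gamma * (grad_at k om 0 q + partial_noise k (batch k) om 0 q)).
  by apply/funext => om; rewrite /iterate /= !mxE mulNr.
apply: sqintbleD => //; apply: sqintbleZ; apply: sqintbleD.
  exact: grad_sqintble.
by have [] := @partial_noise_moment k (batch k) q (batch_uniq k) (@batch_iter k).
Qed.

Lemma batch_noise_sqintble k q : sqintble P (fun om => partial_noise k (batch k) om 0 q).
Proof. by have [] := @partial_noise_moment k (batch k) q (batch_uniq k) (@batch_iter k). Qed.

Lemma grad_noise_mean0 k :
  mean P (fun om => dotv (grad_at k om) (partial_noise k (batch k) om)) = 0.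
Proof.
have sG := grad_sqintble (iterate_sqintble k).
rewrite mean_sum => [|q]; last by apply: sqintbleM => //; exact: batch_noise_sqintble.
apply: big1 => q _.
have -> : (fun om => grad_at k om 0 q * partial_noise k (batch k) om 0 q) =
    (* The guard makes every summand integrable, as [mean_sum] requires for all indices and not just
       those in the list. *)
    (fun om => \sum_(t <- batch k) if t \in batch k then
       a t * (grad_at k om 0 q * sample_noise k t om 0 q) else 0).
  apply/funext => om; rewrite /partial_noise /total_noise summxE mulr_sumr.
  rewrite big_seq [RHS]big_seq; apply: eq_bigr => t tb.
  by rewrite tb [X in _ * X = _]mxE mulrCA.
have iT t : t \in batch k -> intble P (fun om => grad_at k om 0 q * sample_noise k t om 0 q).
  move=> /batch_iter <-; apply: sqintbleM; last exact: sample_noise_sqintble.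
  by apply: grad_sqintble => r; exact: iterate_sqintble.
rewrite mean_sum => [|t]; last first.
  by case tb: (t \in batch k); [exact/intbleZ/iT|exact: intble_cst].
apply: big1_seq => t /andP[_ tb]; rewrite tb meanZ; last exact: iT.
have tk := batch_iter tb.
have := iT _ tb; rewrite -tk => iT'.
pose Q := [pred s : sample_id | (s.1.1 < t.1.1)%N].
have Qt : ~~ Q t by rewrite /= ltnn.
rewrite (fresh_noise_mean0 Qt) ?mulr0 //.
apply: (measurable_favg_grad (Omega := g_sigma_algebraType (cylinders xi Q))) => r.
exact: past_iter.
Qed.

Lemma step_descent k om :
  8 * L * favg f (iterate k.+1 om) <= 8 * L * favg f (iterate k om) +
  (- 3 * dotv (grad_at k om) (grad_at k om) -
   2 * dotv (grad_at k om) (partial_noise k (batch k) om) +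
   dotv (partial_noise k (batch k) om) (partial_noise k (batch k) om)).
Proof.
have := descent (iterate k om) (iterate k.+1 om) smooth.
set x := iterate k om; set e := partial_noise k (batch k) om; set G := grad (favg f) x.
have -> : iterate k.+1 om - x = - gamma *: (G + e) by rewrite /iterate /= addrC addKr scaleNr.
rewrite !dotvZl !dotvZr !dotvDl !dotvDr (dotvC e G).
move: (dotv G G) (dotv G e) (dotv e e) => A C E.
move: (favg f (iterate k.+1 om)) (favg f x) => fy fx h.
rewrite -subr_ge0.
(* With gamma = 1/(2L), the linear term gives -4A - 4C and the quadratic one A + 2C + E. *)
have -> : 8 * L * fx + (- 3 * A - 2 * C + E) - 8 * L * fy =
  8 * L * (fx + - gamma * (A + C) + L / 2 * (- gamma * (- gamma * (A + C + (C + E)))) - fy).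
  by rewrite gammaE; field; rewrite gt_eqF.
by rewrite mulr_ge0 ?mulr_ge0 ?(ltW L0) // subr_ge0.
Qed.

Lemma path_descent K om :
  \sum_(k < K) (3 * dotv (grad_at k om) (grad_at k om) +
   2 * dotv (grad_at k om) (partial_noise k (batch k) om) +
   - 1 * dotv (partial_noise k (batch k) om) (partial_noise k (batch k) om))
  <= 8 * L * (favg f x0 - fstar).
Proof.
apply: (@le_trans _ _ (8 * L * (favg f x0 - favg f (iterate K om)))); last first.
  by apply: ler_wpM2l; [rewrite mulr_ge0 // ltW|rewrite lerD2l lerN2].
elim: K => [|K IH]; first by rewrite big_ord0 subrr mulr0.
rewrite big_ord_recr /=; have := step_descent K om; move: IH; lra.
Qed.

Lemma mean_grad_bound K :
  3 * \sum_(k < K) mean P (fun om => dotv (grad_at k om) (grad_at k om)) <=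
  8 * L * (favg f x0 - fstar) + \sum_(k < K) \sum_(t <- batch k) a t ^+ 2 * sigma ^+ 2.
Proof.
have sG k q := grad_sqintble (iterate_sqintble k) q.
have iG k : intble P (fun om => dotv (grad_at k om) (grad_at k om)).
  by apply: intble_sum => q; apply: sqintbleM.
have iC k : intble P (fun om => dotv (grad_at k om) (partial_noise k (batch k) om)).
  by apply: intble_sum => q; apply: sqintbleM => //; exact: batch_noise_sqintble.
have iE k : intble P (fun om =>
    dotv (partial_noise k (batch k) om) (partial_noise k (batch k) om)).
  by apply: intble_sum => q; apply: sqintbleM; exact: batch_noise_sqintble.
have i2 k : intble P (fun om => 3 * dotv (grad_at k om) (grad_at k om) +
   2 * dotv (grad_at k om) (partial_noise k (batch k) om)).
  by apply: intbleD; exact: intbleZ.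
have i3 k : intble P (fun om => 3 * dotv (grad_at k om) (grad_at k om) +
   2 * dotv (grad_at k om) (partial_noise k (batch k) om) +
   - 1 * dotv (partial_noise k (batch k) om) (partial_noise k (batch k) om)).
  by apply: intbleD => //; exact: intbleZ.
have := mean_le (intble_sum (index_enum 'I_K) (fun k => i3 k)) (intble_cst P _)
  (@path_descent K).
rewrite mean_cst mean_sum //.
under eq_bigr => k _.
  rewrite meanD //; last exact: intbleZ.
  rewrite meanD; [|exact: intbleZ..].
  rewrite !meanZ // grad_noise_mean0 mulr0 addr0.
  over.
rewrite big_split /= -!mulr_sumr mulN1r => h; rewrite -lerBlDr; apply: le_trans h.
rewrite lerD2l lerN2; apply: ler_sum => k _.
apply: le_trans (total_noise_second_moment k).
rewrite mean_sum => [|q]; last by apply: sqintbleM; exact: batch_noise_sqintble.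
by apply: ler_sum => q _; exact: lexx.
Qed.

Lemma past_index_indep (tau : {RV P >-> nat}) d1 (T1 : measurableType d1)
    (Y : Omega -> T1) A B : independent_of_family xi tau ->
  measurable_fun setT (Y : g_sigma_algebraType (cylinders xi predT) -> T1) ->
  measurable A ->
  P (Y @^-1` A `&` tau @^-1` B) = (P (Y @^-1` A) * P (tau @^-1` B))%E.
Proof.
move=> ind mY mA; rewrite muleC.
apply: (@indep_event_sigma _ _ _ _ _ _ _ xi predT).
- exact: measurable_funPTI.
- by move=> J F uJ _ mF; exact: ind.
- by have := mY measurableT _ mA; rewrite setTI.
Qed.

(** The 3 K eps allowed for three times the sum of squared gradients is spent as 2 K eps on the
    initial gap and K eps on the noise, which is where K >= 4 L Delta / eps comes from. *)
Lemma sgd_stationary (eps : R) (K : nat) (tau : {RV P >-> nat}) :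
  (0 < K)%N -> uniform_index K tau -> independent_of_family xi tau ->
  (forall k, \sum_(t <- batch k) a t ^+ 2 * sigma ^+ 2 <= eps) ->
  8 * L * (favg f x0 - fstar) <= 2 * K%:R * eps ->
  (\int[P]_om (dotv (grad_at (tau om) om) (grad_at (tau om) om))%:E <= eps%:E)%E.
Proof.
move=> K0 unif ind Veps Delta.
pose h k om := dotv (grad_at k om) (grad_at k om).
have sG k q := grad_sqintble (iterate_sqintble k) q.
rewrite (mean_uniform_index (h := h) K0 unif) => [||||k A B mA].
- have KR : 0 < K%:R :> R by rewrite ltr0n.
  rewrite lee_fin mulrC ler_pdivrMr // -(ler_pM2l (ltr0n _ 3)).
  apply: le_trans (mean_grad_bound K) _.
  have : \sum_(k < K) \sum_(t <- batch k) a t ^+ 2 * sigma ^+ 2 <= eps * K%:R.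
    rewrite mulr_natr -[X in _ *+ X]card_ord -sumr_const.
    by apply: ler_sum => k _.
  by lra.
- by move=> k; apply: measurable_sum => q; apply: measurable_funM; exact: grad_measurable.
- by move=> k om; exact: dotvv_ge0.
- by move=> k; apply: intble_sum => q; apply: sqintbleM.
(* With Q everything, the past is the sigma-algebra of all samples: every iterate is measurable for
   it and [tau] is independent of it. *)
apply: past_index_indep => //; apply: measurable_sum => q.
have mG : measurable_fun setT
    ((fun om => grad_at k om 0 q) : g_sigma_algebraType (cylinders xi predT) -> R).
  apply: (measurable_favg_grad (Omega := g_sigma_algebraType (cylinders xi predT))) => r.
  apply: (measurable_sgd
    (S := fun s => xi s : g_sigma_algebraType (cylinders xi predT) -> Xi)) => s _.
  exact: cylinder_RV.
exact: measurable_funM.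
Qed.

End Descent.
End Moments.
End Process.

(** * Leon SGD *)

Section LeonBatch.
Variables (R : realType) (n : nat) (B : 'I_n -> nat).

Definition leon_batch (k : nat) : seq (nat * 'I_n * nat) :=
  [seq (k, i, j) | i <- enum 'I_n, j <- iota 0 (B i)].

Definition leon_weight (t : nat * 'I_n * nat) : R := (n%:R * (B t.1.2)%:R)^-1.

Lemma leon_batch_iter k t : t \in leon_batch k -> t.1.1 = k.
Proof. by move=> /allpairsPdep[i [j [_ _ ->]]]. Qed.

Lemma leon_batch_uniq k : uniq (leon_batch k).
Proof.
apply: allpairs_uniq_dep; first exact: enum_uniq.
  by move=> i _; exact: iota_uniq.
by move=> [i j] [i' j'] _ _ /= [-> ->].
Qed.

Lemma sum_leon_batch (V : nmodType) k (F : nat * 'I_n * nat -> V) :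
  \sum_(t <- leon_batch k) F t = \sum_i \sum_(j < B i) F (k, i, val j).
Proof.
rewrite big_allpairs_dep big_enum; apply: eq_bigr => i _.
by rewrite -(big_mkord xpredT (fun j => F (k, i, j))) /index_iota subn0.
Qed.

End LeonBatch.

(** The B_i weights 1/(n B_i) of worker i add up to 1/n, so the gradients subtracted inside the
    noise cancel the full gradient and leave the averaged mini-batches. *)
Lemma leon_sgd (R : realType) (n d : nat) dX (Xi : measurableType dX) (G : network n)
  (T : packing G) (f : 'I_n -> 'rV[R]_d -> R) (g : 'I_n -> 'rV[R]_d -> Xi -> 'rV[R]_d)
  (gamma : R) (B : 'I_n -> nat) (x0 : 'rV[R]_d) (s : nat * 'I_n * nat -> Xi) k u :
  (0 < n)%N -> (forall i, (0 < B i)%N) -> (forall i x, differentiable (f i) x) ->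
  leon T g gamma B x0 s k u = sgd f g x0 gamma (leon_weight R B) (leon_batch B) s k.
Proof.
move=> n0 B0 df; elim: k u => //= k IH u.
rewrite allreduce_sum IH /total_noise sum_leon_batch; congr (_ - _).
set x := sgd _ _ _ _ _ _ _ k.
rewrite -scalerA; congr (_ *: _).
under eq_bigr do (under eq_bigr do rewrite IH -/x).
rewrite grad_favg // !scaler_sumr -big_split /=; apply: eq_bigr => i _.
rewrite /leon_weight /noise /=.
under [X in _ = _ + X]eq_bigr do rewrite scalerBr.
rewrite sumrB sumr_const card_ord scalerMnl !scalerA -scaler_sumr.
have Bi : (B i)%:R != 0 :> R by rewrite pnatr_eq0 -lt0n.
have nn : n%:R != 0 :> R by rewrite pnatr_eq0 -lt0n.
have -> : (n%:R * (B i)%:R)^-1 *+ B i = n%:R^-1 :> R.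
  by rewrite -[LHS]mulr_natr; field; rewrite Bi nn.
by rewrite invfM addrC subrK.
Qed.

Lemma leon_batch_variance (R : realType) n (B : 'I_n -> nat) (sigma : R) k :
  \sum_(t <- leon_batch B k) leon_weight R B t ^+ 2 * sigma ^+ 2 =
  \sum_i (n%:R * (B i)%:R)^-2 * ((B i)%:R * sigma ^+ 2).
Proof.
rewrite sum_leon_batch; apply: eq_bigr => i _.
by rewrite /leon_weight /= sumr_const card_ord exprVn -mulrnAr -[in LHS](mulr_natl (sigma ^+ 2)).
Qed.

Lemma leon_clockE (R : realType) n (G : network n) (T : packing G) d h (sigma eps : R) k :
  leon_clock T d h sigma eps k =
  k%:R * (compute_time h sigma eps + allreduce_time R T d).
Proof.
elim: k => [|k IH] /=; first by rewrite mul0r.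
by rewrite IH -addrA -[k.+1%:R]natr1 mulrDl mul1r.
Qed.

Section TimeScale.
Context (R : realType) (n : nat) (G : network n) (T : packing G) (d : nat)
  (h : 'I_n -> R) (sigma eps kappa : R).
Hypotheses (n0 : (0 < n)%N) (h0 : forall i, 0 < h i) (eps0 : 0 < eps)
  (kappa0 : 0 < kappa) (opt : near_optimal kappa T) (large : large_dim R G d).

Lemma time_scale_fin : exists s : R,
  [/\ time_scale d h sigma eps (global_mincut R G) = s%:E, compute_scale h sigma eps <= s &
    allreduce_time R T d <= 2 * (kappa + 2) * s].
Proof.
have [r rE] : exists r : R, (d%:R%:E * (global_mincut R G)^-1 = r%:E)%E.
  have [n1|n1] := leqP n 1; last first.
    have [W [W0 WT ->]] := global_mincutP R G n1.
    by rewrite inver gt_eqF ?cut_value_gt0 // -EFinM; eexists.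
  (* A single vertex has no proper nonempty subset, so the minimum cut is +oo and its inverse 0. *)
  exists 0; rewrite /global_mincut big_pred0 ?mule0 // => U; apply/negP => /andP[U0 UT].
  have [a [b [aU]]] := nontrivial_sep U0 UT; have -> : b = a; last by rewrite aU.
  by apply: val_inj; have := ltn_ord a; have := ltn_ord b => /=; lia.
exists (Num.max r (compute_scale h sigma eps)); split.
- by rewrite /time_scale rE -EFin_max.
- by rewrite le_max lexx orbT.
have := allreduce_time_bound kappa0 opt large; rewrite rE -EFinM lee_fin => /le_trans; apply.
have k2 : 0 <= 2 * (kappa + 2) by rewrite mulr_ge0 // addr_ge0 // ltW.
by apply: ler_wpM2l => //; rewrite le_max lexx.
Qed.

(** Each iteration costs at most 4 time scales of computation and 2 (kappa + 2) of AllReduce. *)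
Lemma leon_clock_le k (x : R) : k%:R <= x ->
  ((leon_clock T d h sigma eps k)%:E <=
   (4 + 2 * (kappa + 2))%:E * time_scale d h sigma eps (global_mincut R G) * x%:E)%E.
Proof.
move=> kx; have [s [-> cs as_]] := time_scale_fin.
rewrite -!EFinM lee_fin leon_clockE.
have ct := compute_time_le sigma n0 h0 eps0; have c0 := compute_scale_gt0 sigma eps n0 h0.
have s1 : 0 <= s by lra.
have s0 : 0 <= (4 + 2 * (kappa + 2)) * s
  by apply: mulr_ge0 => //; rewrite addr_ge0 ?mulr_ge0 ?addr_ge0 // ltW.
have le_s : compute_time h sigma eps + allreduce_time R T d <= (4 + 2 * (kappa + 2)) * s by lra.
apply: (@le_trans _ _ (k%:R * ((4 + 2 * (kappa + 2)) * s))); first by apply: ler_wpM2l.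
by rewrite mulrC; apply: ler_wpM2l.
Qed.

End TimeScale.

Theorem theorem1p7 (R : realType) :
  (exists kappa : R, 0 < kappa /\
     forall (n : nat) (G : network n), (0 < n)%N ->
       exists T : packing G, near_optimal kappa T)
  /\
  forall kappa : R, 0 < kappa ->
  exists c1 c2 C : R, [/\ 0 < c1, 0 < c2, 0 < C &
  forall (n : nat) (G : network n) (T : packing G) (d : nat)
    (dX : measure_display) (Xi : measurableType dX)
    (D : 'I_n -> probability Xi R)
    (f : 'I_n -> 'rV[R]_d -> R) (g : 'I_n -> 'rV[R]_d -> Xi -> 'rV[R]_d)
    (L fstar sigma eps : R) (x0 : 'rV[R]_d) (h : 'I_n -> R),
    (0 < n)%N -> near_optimal kappa T -> large_dim R G d ->
    0 < L -> L_smooth (favg f) L ->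
    (forall x, fstar <= favg f x) ->
    stochastic_oracle D f g sigma ->
    0 < eps -> (forall i, 0 < h i) ->
    let Delta := favg f x0 - fstar in
    let rate := L * Delta / eps in
    let clock := leon_clock T d h sigma eps in
    let B := batches h (compute_time h sigma eps) in
    let gamma := (2 * L)^-1 in
    exists K : nat,
    [/\ (0 < K)%N /\ c1 * rate <= K%:R <= c2 * Num.max 1 rate,
      (* the K iterations produce x^0, ..., x^(K-1) *)
      forall (dO : measure_display) (Omega : measurableType dO)
        (P : probability Omega R) (xi : nat * 'I_n * nat -> {RV P >-> Xi})
        (tau : {RV P >-> nat}),
        iid_samples D xi -> uniform_index K tau ->
        independent_of_family xi tau ->
        forall u : 'I_n,
          ('E_P[fun om => (enorm (grad (favg f)
                  (leon T g gamma B x0 (fun t => xi t om) (tau om) u)) ^+ 2)%R]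
             <= eps%:E)%E,
      (* the last of these is held by all workers at time clock K.-1 *)
      forall (F : rel 'I_n) (w : 'I_n -> 'I_n -> R), gomory_hu G F w ->
        let w1 := min_tree_weight F w in
        [/\ w1 = global_mincut R G,
            ((clock K.-1)%:E <= C%:E * time_scale d h sigma eps w1 * rate%:E)%E
          & ((clock K)%:E
               <= C%:E * time_scale d h sigma eps w1 * (Num.max 1 rate)%:E)%E]
    & let w1 := global_mincut R G in
      ((clock K.-1)%:E <= C%:E * time_scale d h sigma eps w1 * rate%:E)%E /\
      ((clock K)%:E
         <= C%:E * time_scale d h sigma eps w1 * (Num.max 1 rate)%:E)%E]].
Proof.
split; first by exists 3; split=> // n G; apply: packing_exists.
move=> kappa kappa0; exists 4, 5, (5 * (4 + 2 * (kappa + 2))).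
split=> //; first by rewrite mulr_gt0 //; lra.
move=> n G T d dX Xi D f g L fstar sigma eps x0 h n0 opt large L0 smooth fmin oracle eps0 h0.
move=> Delta rate clock B gamma.
have Delta0 : 0 <= Delta by rewrite subr_ge0.
have rate0 : 0 <= rate by rewrite divr_ge0 ?mulr_ge0 // ltW.
(* K exceeds 4 rate and is positive even if the rate is 0. Thus K - 1 <= 4 rate, whereas K itself is
   bounded by 4 rate + 1 <= 5 max(1, rate), the source of both constants 5. *)
pose K := (Num.truncn (4 * rate)).+1.
have Km : K.-1%:R <= 4 * rate by rewrite truncn_le mulr_ge0.
have KM : 4 * rate < K%:R by exact: truncnS_gt.
have Kp : K%:R = K.-1%:R + 1 :> R by rewrite natr1.
have max1 : 1 <= Num.max 1 rate by rewrite le_max lexx.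
have maxr : rate <= Num.max 1 rate by rewrite le_max lexx orbT.
have times : let w1 := global_mincut R G in
    ((clock K.-1)%:E <= (5 * (4 + 2 * (kappa + 2)))%:E * time_scale d h sigma eps w1 * rate%:E)%E /\
    ((clock K)%:E <= (5 * (4 + 2 * (kappa + 2)))%:E * time_scale d h sigma eps w1 *
       (Num.max 1 rate)%:E)%E.
  have shift5 (S x : \bar R) : ((5 * (4 + 2 * (kappa + 2)))%:E * S * x =
      (4 + 2 * (kappa + 2))%:E * S * (5%:E * x))%E.
    by rewrite mulrC EFinM -!muleA (muleCA 5%:E).
  split; rewrite shift5 -EFinM; apply: leon_clock_le => //; lra.
exists K; split => //.
- by split=> //; apply/andP; split; lra.
- move=> dO Omega P xi tau iid unif ind u.
  have enB := enough_compute_time sigma n0 h0 eps0.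
  have B0 i : (0 < B i)%N by case: enB.
  have df : forall i x, differentiable (f i) x by case: oracle.
  rewrite unlock.
  under eq_integral do rewrite (leon_sgd T g gamma x0 _ _ u n0 B0 df) enorm_sqr.
  apply: (sgd_stationary oracle (leon_batch_iter (B := B)) (leon_batch_uniq B) iid
    L0 smooth fmin _ _ unif ind) => //.
    move=> k; rewrite leon_batch_variance.
    exact: variance_bound enB.
  have : L * Delta = rate * eps by rewrite divfK // gt_eqF.
  rewrite -/Delta -mulrA => ->; nra.
by move=> F w GH w1; rewrite /w1 (min_tree_weight_mincut GH); case: times.
Qed.
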